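(* Let $0 \leq \beta < 1$, and let $f(z) = z + a_2 z^2 + a_3 z^3 + a_4 z^4 + \cdots$ belong to the class $\mathcal{K}_{\Sigma}(\beta)$ of bi-close-to-convex functions of order $\beta$. Then $$|a_{2}a_{4}-a_{3}^2| \leq \frac{1}{8}+ \frac{19}{6}(1-\beta)+6(1-\beta)^2+ 4(1-\beta)^3+(1-\beta)^4 .$$
   Context: Let $\mathbb{D}=\{z\in\mathbb{C}: |z|<1\}$. Let $\mathcal{S}$ be the class of univalent analytic functions $f$ on $\mathbb{D}$ with expansion $f(z)=z+a_2z^2+a_3z^3+\cdots$. The class $\Sigma$ of bi-univalent functions consists of all $f\in\mathcal{S}$ whose inverse $f^{-1}$ (defined near $0$) has a univalent analytic continuation $g$ to all of $\mathbb{D}$. It has the expansion $g(w)= w - a_{2}w^{2}+(2a_{2}^{2}-a_{3})w^{3}-(5a_{2}^{3}-5a_{2}a_{3}+a_{4})w^{4}+\cdots$. The class $\mathcal{CV}$ of convex functions consists of $h\in\mathcal{S}$ with $\Re\left(1+zh''(z)/h'(z)\right)>0$ for $z\in\mathbb{D}$. The class $\mathcal{CV}_\Sigma$ of bi-convex functions consists of those $h\in\Sigma$ such that both $h$ and the analytic continuation of $h^{-1}$ to $\mathbb{D}$ belong to $\mathcal{CV}$. For $0\le\beta<1$, a function $f\in\Sigma$ is bi-close-to-convex of order $\beta$, written $f\in\mathcal{K}_\Sigma(\beta)$, if there exist bi-convex functions $\phi(z)=z+c_2z^2+c_3z^3+c_4z^4+\cdots$ and $\psi$ in $\mathcal{CV}_\Sigma$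 such that $$\Re\left(\frac{f'(z)}{\phi'(z)}\right)>\beta\quad\text{and}\quad \Re\left(\frac{g'(w)}{\psi'(w)}\right)>\beta\qquad (z,w\in\mathbb{D}),$$ where $g$ is the analytic continuation of $f^{-1}$ to $\mathbb{D}$. It is assumed that $\psi$ is the analytic continuation of $\phi^{-1}$ to $\mathbb{D}$, so $\psi(w)= w - c_{2}w^{2}+(2c_{2}^{2} - c_{3})w^{3}-(5c_{2}^{3}-5c_{2}c_{3}+c_{4})w^{4}+\cdots$. *)

(* Defs.v *)
From Stdlib Require Import Reals.
From Coquelicot Require Import Coquelicot.

Open Scope R_scope.

(* All functions are total maps C -> C of which only the restriction to the
   open unit disk matters: the disk is open, so [C_derive f z] at a point [z] of
   the disk does not depend on the values of [f] outside it. *)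

Definition unit_disk (z : C) : Prop := Cmod z < 1.

Definition analytic_at (f : C -> C) (z0 : C) : Prop :=
  exists (b : nat -> C) (r : R),
    0 < r /\ forall h : C, Cmod h < r -> is_pseries b h (f (z0 + h)%C).

Definition analytic_disk (f : C -> C) : Prop :=
  forall z, unit_disk z -> analytic_at f z.

Definition univalent_disk (f : C -> C) : Prop :=
  forall z1 z2, unit_disk z1 -> unit_disk z2 -> f z1 = f z2 -> z1 = z2.

(* f(z) = z + a_2 z^2 + a_3 z^3 + ... on the unit disk *)
Definition normalized_expansion (f : C -> C) (a : nat -> C) : Prop :=
  a 0%nat = RtoC 0 /\ a 1%nat = RtoC 1 /\
  forall z, unit_disk z -> is_pseries a z (f z).

Definition class_S (f : C -> C) : Prop :=
  analytic_disk f /\ univalent_disk f /\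
  exists a : nat -> C, normalized_expansion f a.

(* g is an analytic function on the disk that coincides near 0 with the inverse
   of f : disk -> f(disk). *)
Definition inverse_continuation (f g : C -> C) : Prop :=
  analytic_disk g /\
  exists eps : R, 0 < eps /\
    forall w : C, Cmod w < eps -> unit_disk (g w) /\ f (g w) = w.

Definition class_Sigma (f : C -> C) : Prop :=
  class_S f /\
  exists g : C -> C, inverse_continuation f g /\ univalent_disk g.

(* The totality of division is harmless here and in [class_K_Sigma]: the
   derivative in the denominator is that of a function univalent on the disk,
   hence does not vanish there. *)
Definition class_CV (h : C -> C) : Prop :=
  class_S h /\
  forall z, unit_disk z ->
    0 < Re (1 + z * C_derive (C_derive h) z / C_derive h z)%C.

Definition class_CV_Sigma (h : C -> C) : Prop :=
  class_Sigma h /\ class_CV h /\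
  exists k : C -> C, inverse_continuation h k /\ class_CV k.

Definition class_K_Sigma (beta : R) (f : C -> C) : Prop :=
  class_Sigma f /\
  exists g phi psi : C -> C,
    inverse_continuation f g /\
    class_CV_Sigma phi /\ class_CV_Sigma psi /\
    inverse_continuation phi psi /\
    (forall z, unit_disk z -> beta < Re (C_derive f z / C_derive phi z)%C) /\
    (forall w, unit_disk w -> beta < Re (C_derive g w / C_derive psi w)%C).

(* Main.v *)
Require Import Defs.
From Stdlib Require Import Reals Lra Lia Psatz.
From Coquelicot Require Import Coquelicot.

(** Write [phi] for the convex function attached to [f], [t = 1 - beta],
    [f' / phi' = beta + t p] and [1 + z phi'' / phi' = P], where [p] and [P] are
    Caratheodory functions. The coefficients of [f] are polynomials in those of
    [phi] and [p], and [a2 a4 - a3^2] becomes a quadratic polynomial in [t]: its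
    constant term is the Hankel determinant of [phi], at most 1/8, and the other
    two are bounded, using [|p_k| <= 2], [|c_k| <= 1] and the Fekete-Szego bound
    [|c3 - (3/4) c2^2| <= 1/3], by 28/9 and 5.

    All the coefficient bounds come from the positivity of the Toeplitz form of a
    Caratheodory function, obtained by integrating [Re p |q|^2] over circles for
    a polynomial [q] of degree 3. The integral of [Re H] over the circle of
    radius [r] does not depend on [r] when [H] is holomorphic in the punctured
    disk, so it can be evaluated as [r -> 0] from the expansion of [H] at 0: no
    power series of the quotient [p] on the whole disk is required. *)

(** * Complex continuity and differentiability *)

(** The bounds [|c_k| <= 1] alone give only 2 for the constant term [c2 c4 - c3^2]; the value 1/8
    needs the joint constraint on c2, c3 and c4. This is why the Toeplitz form is kept for arbitrary
    vectors. It is then read through the Schur function w defined by P = (1 + z w) / (1 - z w): its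
    coefficients b0, b1, b2 are polynomials in the c's, the form becomes a contraction property, and
    that property yields Schwarz-Pick inequalities for w and for its first Schur transform. On the
    analytic side, holomorphy acts only through real Riemann integrals over circles. Real and
    imaginary parts are therefore handled separately, and a continuous derivative, which power
    series supply, is made part of the notion used. *)

Definition ccont {U : UniformSpace} (f : U -> C) (x : U) : Prop :=
  continuous (fun u => Re (f u)) x /\ continuous (fun u => Im (f u)) x.

Lemma ccont_ext_loc {U : UniformSpace} (f g : U -> C) (x : U) :
  locally x (fun u => f u = g u) -> ccont f x -> ccont g x.
Proof.
  intros E [H1 H2]; split.
  - apply continuous_ext_loc with (2 := H1).
    now apply (filter_imp (fun u => f u = g u)); [intros u ->|].
  - apply continuous_ext_loc with (2 := H2).
    now apply (filter_imp (fun u => f u = g u)); [intros u ->|].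
Qed.

Lemma ccont_const {U : UniformSpace} (c : C) (x : U) : ccont (fun _ => c) x.
Proof. split; apply continuous_const. Qed.

Lemma ccont_id (z : C) : ccont (U := C_UniformSpace) (fun w => w) z.
Proof. destruct z; split; [apply continuous_fst | apply continuous_snd]. Qed.

Lemma ccont_plus {U : UniformSpace} (f g : U -> C) (x : U) :
  ccont f x -> ccont g x -> ccont (fun u => f u + g u)%C x.
Proof.
  intros [f1 f2] [g1 g2]; split; simpl.
  - exact (continuous_plus _ _ x f1 g1).
  - exact (continuous_plus _ _ x f2 g2).
Qed.

Lemma ccont_mult {U : UniformSpace} (f g : U -> C) (x : U) :
  ccont f x -> ccont g x -> ccont (fun u => f u * g u)%C x.
Proof.
  intros [f1 f2] [g1 g2]; split; simpl.
  - exact (continuous_minus _ _ x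
             (continuous_mult (K := R_AbsRing) _ _ x f1 g1)
             (continuous_mult (K := R_AbsRing) _ _ x f2 g2)).
  - exact (continuous_plus _ _ x
             (continuous_mult (K := R_AbsRing) _ _ x f1 g2)
             (continuous_mult (K := R_AbsRing) _ _ x f2 g1)).
Qed.

Lemma ccont_opp {U : UniformSpace} (f : U -> C) (x : U) :
  ccont f x -> ccont (fun u => - f u)%C x.
Proof.
  intros [f1 f2]; split; simpl.
  - exact (continuous_opp _ x f1).
  - exact (continuous_opp _ x f2).
Qed.

Lemma sqr_mod_neq_0 (z : C) : z <> 0 -> Re z ^ 2 + Im z ^ 2 <> 0.
Proof.
  intros Hz. rewrite <- Cmod2_alt. apply pow_nonzero.
  apply Rgt_not_eq. now apply Cmod_gt_0.
Qed.

Lemma ccont_inv {U : UniformSpace} (f : U -> C) (x : U) :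
  f x <> 0 -> ccont f x -> ccont (fun u => / f u)%C x.
Proof.
  intros Hz [f1 f2].
  assert (Hd : continuous (fun u => / (Re (f u) ^ 2 + Im (f u) ^ 2)) x).
  { apply (continuous_comp (fun u => Re (f u) ^ 2 + Im (f u) ^ 2) Rinv).
    - apply continuous_ext with
        (fun u => plus (mult (K := R_AbsRing) (Re (f u)) (Re (f u)))
                       (mult (K := R_AbsRing) (Im (f u)) (Im (f u)))).
      + intros u; unfold plus, mult; simpl; ring.
      + apply (continuous_plus (V := R_NormedModule));
          now apply (continuous_mult (K := R_AbsRing)).
    - apply continuous_Rinv. now apply sqr_mod_neq_0. }
  split; simpl.
  - exact (continuous_mult (K := R_AbsRing) _ _ x f1 Hd).
  - exact (continuous_mult (K := R_AbsRing) _ _ x (continuous_opp _ x f2) Hd).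
Qed.

Lemma ccont_comp {U : UniformSpace} (g : U -> C) (f : C -> C) (x : U) :
  ccont g x -> ccont (U := C_UniformSpace) f (g x) -> ccont (fun u => f (g u)) x.
Proof.
  intros [g1 g2] [f1 f2].
  assert (E : forall c : C, c = (Re c, Im c)) by now intros [].
  split.
  - apply continuous_ext with (fun u => Re (f (Re (g u), Im (g u)))).
    { intros u; now rewrite <- E. }
    apply (continuous_comp_2 (fun u => Re (g u)) (fun u => Im (g u))
             (fun a b => Re (f (a, b)))); try assumption.
    rewrite <- E.
    apply continuous_ext with (2 := f1).
    now intros [].
  - apply continuous_ext with (fun u => Im (f (Re (g u), Im (g u)))).
    { intros u; now rewrite <- E. }
    apply (continuous_comp_2 (fun u => Re (g u)) (fun u => Im (g u))
             (fun a b => Im (f (a, b)))); try assumption.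
    rewrite <- E.
    apply continuous_ext with (2 := f2).
    now intros [].
Qed.

(* Caratheodory's formulation of complex differentiability. *)
Definition cdiff (f : C -> C) (z l : C) : Prop :=
  exists q : C -> C,
    locally (T := C_UniformSpace) z (fun w => f w - f z = q w * (w - z))%C /\
    q z = l /\
    ccont (U := C_UniformSpace) q z.

Lemma cdiff_ccont (f : C -> C) (z l : C) :
  cdiff f z l -> ccont (U := C_UniformSpace) f z.
Proof.
  intros (q & E & _ & Hc).
  apply ccont_ext_loc with (fun w => f z + q w * (w + - z))%C.
  { revert E; apply filter_imp; intros w E.
    replace (q w * (w + - z))%C with (f w - f z)%C by now rewrite E.
    ring. }
  apply ccont_plus; [apply ccont_const|].
  apply ccont_mult; [exact Hc|].
  apply ccont_plus; [apply ccont_id | apply ccont_const].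
Qed.

Lemma cdiff_const (c z : C) : cdiff (fun _ => c) z 0.
Proof.
  exists (fun _ => RtoC 0); split; [apply filter_forall; intros w; ring|].
  split; [reflexivity | apply ccont_const].
Qed.

Lemma cdiff_id (z : C) : cdiff (fun w => w) z 1.
Proof.
  exists (fun _ => RtoC 1); split; [apply filter_forall; intros w; ring|].
  split; [reflexivity | apply ccont_const].
Qed.

Lemma cdiff_plus (f g : C -> C) (z l m : C) :
  cdiff f z l -> cdiff g z m -> cdiff (fun w => f w + g w)%C z (l + m)%C.
Proof.
  intros (p & Ep & p0 & Cp) (q & Eq & q0 & Cq).
  exists (fun w => p w + q w)%C; split; [|split].
  - generalize (filter_and _ _ Ep Eq); apply filter_imp; clear Ep Eq; intros w [Ep Eq].
    replace (f w + g w - (f z + g z))%C with ((f w - f z) + (g w - g z))%C by ring.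
    rewrite Ep, Eq; ring.
  - now rewrite p0, q0.
  - now apply ccont_plus.
Qed.

Lemma cdiff_mult (f g : C -> C) (z l m : C) :
  cdiff f z l -> cdiff g z m ->
  cdiff (fun w => f w * g w)%C z (l * g z + f z * m)%C.
Proof.
  intros Hf Hg. pose proof (cdiff_ccont _ _ _ Hg) as Cg.
  destruct Hf as (p & Ep & p0 & Cp), Hg as (q & Eq & q0 & Cq).
  exists (fun w => p w * g w + f z * q w)%C; split; [|split].
  - generalize (filter_and _ _ Ep Eq); apply filter_imp; clear Ep Eq; intros w [Ep Eq].
    replace (f w * g w - f z * g z)%C
      with ((f w - f z) * g w + f z * (g w - g z))%C by ring.
    rewrite Ep, Eq; ring.
  - now rewrite p0, q0.
  - apply ccont_plus; apply ccont_mult; trivial; apply ccont_const.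
Qed.

(** Dividing a quadratic remainder by [w - z] leaves a difference quotient within [K |w - z|] of
    [l], which is continuity at [z] of the quotient completed by the value [l]. *)
Lemma cdiff_quadratic (f : C -> C) (z l : C) (d K : R) : 0 < d ->
  (forall w, Cmod (w - z) < d ->
     Cmod (f w - f z - l * (w - z)) <= K * Cmod (w - z) ^ 2) ->
  cdiff f z l.
Proof.
  intros Hd H.
  assert (HK : forall w, w <> z ->
    Cmod (w - z) < d -> Cmod ((f w - f z) / (w - z) - l) <= K * Cmod (w - z)).
  { intros w Hw Hwd.
    assert (Hz : (w - z)%C <> 0).
    { intros E; apply Hw. replace w with ((w - z) + z)%C by ring. rewrite E; ring. }
    pose proof (proj1 (Cmod_gt_0 _) Hz) as Hp.
    replace ((f w - f z) / (w - z) - l)%C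
      with ((f w - f z - l * (w - z)) / (w - z))%C by (field; exact Hz).
    rewrite Cmod_div by exact Hz.
    apply Rle_div_l; [exact Hp|].
    specialize (H w Hwd). nra. }
  set (q := fun w => if Ceq_dec w z then l else ((f w - f z) / (w - z))%C).
  assert (Hq : forall w, Cmod (w - z) < d -> Cmod (q w - l) <= Rabs K * Cmod (w - z)).
  { intros w Hw. unfold q. destruct (Ceq_dec w z) as [->|n].
    - replace (l - l)%C with (RtoC 0) by ring. rewrite Cmod_0.
      apply Rmult_le_pos; [apply Rabs_pos | apply Cmod_ge_0].
    - apply Rle_trans with (1 := HK w n Hw).
      apply Rmult_le_compat_r; [apply Cmod_ge_0 | apply Rle_abs]. }
  assert (q0 : q z = l) by (unfold q; now destruct (Ceq_dec z z)).
  exists q; split; [|split; [exact q0|]].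
  - apply filter_forall. intros w. unfold q. destruct (Ceq_dec w z) as [->|n]; [ring|].
    field. intros E; apply n. replace w with ((w - z) + z)%C by ring. rewrite E; ring.
  - pose proof (Rabs_pos K) as HKp.
    assert (Hlim : forall eps : posreal, locally (T := C_UniformSpace) z
              (fun w => Cmod (q w - q z) < eps)).
    { intros [eps He]; simpl.
      (* A product ball of radius [e] only ensures [|w - z| < 2 e], whence both factors 2. The [+ 1]
         covers [K = 0]. *)
      set (e := Rmin (d / 2) (eps / (2 * (Rabs K + 1)))).
      assert (0 < eps / (2 * (Rabs K + 1))) by (apply Rdiv_lt_0_compat; lra).
      assert (He' : 0 < e) by (unfold e; apply Rmin_glb_lt; lra).
      exists (mkposreal e He'). intros w Hw.
      destruct Hw as [B1 B2].
      change (Rabs (fst w - fst z) < e) in B1. change (Rabs (snd w - snd z) < e) in B2.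
      assert (Hm : Cmod (w - z) < 2 * e).
      { replace (w - z)%C with (RtoC (fst w - fst z) + Ci * RtoC (snd w - snd z))%C.
        2:{ apply injective_projections; simpl; ring. }
        apply Rle_lt_trans with (1 := Cmod_triangle _ _).
        rewrite Cmod_mult, Cmod_Ci, !Cmod_R. lra. }
      assert (e <= d / 2) by apply Rmin_l.
      assert (e <= eps / (2 * (Rabs K + 1))) by apply Rmin_r.
      rewrite q0.
      apply Rle_lt_trans with (Rabs K * Cmod (w - z)); [apply Hq; lra|].
      apply Rle_lt_trans with (Rabs K * (2 * e)).
      { apply Rmult_le_compat_l; lra. }
      apply Rle_lt_trans with (Rabs K * (2 * (eps / (2 * (Rabs K + 1))))).
      { apply Rmult_le_compat_l; lra. }
      replace (Rabs K * (2 * (eps / (2 * (Rabs K + 1)))))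
        with (eps * (Rabs K / (Rabs K + 1))) by (field; lra).
      rewrite <- (Rmult_1_r eps) at 2. apply Rmult_lt_compat_l; [exact He|].
      apply Rlt_div_l; lra. }
    split; apply filterlim_locally; intros eps; generalize (Hlim eps);
      apply filter_imp; intros w Hw.
    + change (Rabs (Re (q w) - Re (q z)) < eps).
      apply Rle_lt_trans with (2 := Hw).
      exact (re_le_Cmod (q w - q z)).
    + change (Rabs (Im (q w) - Im (q z)) < eps).
      apply Rle_lt_trans with (2 := Hw).
      exact (Rle_trans _ _ _ (Rmax_r _ _) (Rmax_Cmod (q w - q z)%C)).
Qed.


Lemma ccont_neq_0 {U : UniformSpace} (f : U -> C) (x : U) :
  f x <> 0 -> ccont f x -> locally x (fun u => f u <> 0).
Proof.
  intros Hz [f1 f2].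
  assert (Hc : continuous (fun u => Re (f u) ^ 2 + Im (f u) ^ 2) x).
  { apply continuous_ext with
        (fun u => plus (mult (K := R_AbsRing) (Re (f u)) (Re (f u)))
                       (mult (K := R_AbsRing) (Im (f u)) (Im (f u)))).
    - intros u; unfold plus, mult; simpl; ring.
    - apply (continuous_plus (V := R_NormedModule));
        now apply (continuous_mult (K := R_AbsRing)). }
  assert (H : locally x (fun u => Re (f u) ^ 2 + Im (f u) ^ 2 <> 0))
    by exact (Hc (fun y => y <> 0) (open_neq 0 _ (sqr_mod_neq_0 _ Hz))).
  revert H; apply filter_imp; intros u Hu E; apply Hu.
  rewrite E; simpl; ring.
Qed.

Lemma cdiff_inv (g : C -> C) (z m : C) :
  g z <> 0 -> cdiff g z m -> cdiff (fun w => / g w)%C z (- (m / (g z * g z)))%C.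
Proof.
  intros Hz Hg. pose proof (cdiff_ccont _ _ _ Hg) as Cg.
  destruct Hg as (q & Eq & q0 & Cq).
  exists (fun w => - (q w * / (g w * g z)))%C; split; [|split].
  - generalize (filter_and _ _ Eq (ccont_neq_0 _ _ Hz Cg)); apply filter_imp.
    intros w [E Hw].
    replace (- (q w * / (g w * g z)) * (w - z))%C
      with (- (q w * (w - z) * / (g w * g z)))%C by ring.
    rewrite <- E. field. now split.
  - now rewrite q0.
  - apply ccont_opp, ccont_mult; [exact Cq|].
    apply ccont_inv; [now apply Cmult_neq_0|].
    apply ccont_mult; [exact Cg | apply ccont_const].
Qed.

Lemma cdiff_C_derive (f : C -> C) (z l : C) : cdiff f z l -> C_derive f z = l.
Proof.
  intros (q & Eq & q0 & [Cq1 Cq2]).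
  apply is_C_derive_unique. split; [apply is_linear_scal_l|].
  intros x Hx.
  replace x with z by exact (is_filter_lim_locally_unique (V := AbsRing_NormedModule C_AbsRing) z x Hx).
  intros eps.
  assert (He : 0 < eps / 2) by (destruct eps; simpl; lra).
  pose proof (proj1 (filterlim_locally _ _) Cq1 (mkposreal _ He)) as H1.
  pose proof (proj1 (filterlim_locally _ _) Cq2 (mkposreal _ He)) as H2.
  (* [C_derive] uses the neighbourhoods given by the modulus, [cdiff] those of the product R x R;
     the two filters agree. *)
  apply locally_C.
  generalize (filter_and _ _ Eq (filter_and _ _ H1 H2)); apply filter_imp. intros w (E & B1 & B2).
  change (Rabs (Re (q w) - Re (q z)) < eps / 2) in B1.
  change (Rabs (Im (q w) - Im (q z)) < eps / 2) in B2.
  change (Cmod (f w - f z - (w - z) * l) <= eps * Cmod (w - z)).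
  rewrite E, <- q0.
  replace (q w * (w - z) - (w - z) * q z)%C with ((q w - q z) * (w - z))%C by ring.
  rewrite Cmod_mult. apply Rmult_le_compat_r; [apply Cmod_ge_0|].
  replace (q w - q z)%C
    with (RtoC (Re (q w) - Re (q z)) + Ci * RtoC (Im (q w) - Im (q z)))%C
    by (apply injective_projections; simpl; unfold Re, Im; ring).
  apply Rle_trans with (1 := Cmod_triangle _ _).
  rewrite Cmod_mult, Cmod_Ci, !Cmod_R. lra.
Qed.

(** The product rule is out of reach because [A] is merely continuous, but the other factor vanishes
    at [t], so only the value [A t] counts to first order. *)
Lemma is_derive_continuous_mult_sub (A x : R -> R) (t dx : R) :
  continuous A t -> is_derive x t dx ->
  is_derive (fun s => A s * (x s - x t)) t (A t * dx).
Proof.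
  intros HA Hx. apply is_derive_Reals. apply is_derive_Reals in Hx.
  intros eps He.
  (* [K] majorizes the coefficients of [e] in the three error terms below; [e <= 1] absorbs the
     quadratic one. *)
  set (K := Rabs (A t) + Rabs dx + 2).
  assert (HK : 0 < K) by (pose proof (Rabs_pos (A t)); pose proof (Rabs_pos dx); unfold K; lra).
  set (e := Rmin 1 (eps / K)).
  assert (He' : 0 < e).
  { apply Rmin_glb_lt; [lra | now apply Rdiv_lt_0_compat]. }
  assert (He1 : e <= 1) by apply Rmin_l.
  assert (He2 : e <= eps / K) by apply Rmin_r.
  destruct (Hx e He') as [d1 H1].
  pose proof (proj1 (filterlim_locally _ _) HA (mkposreal _ He')) as [d2 H2].
  assert (Hd : 0 < Rmin d1 d2) by (apply Rmin_glb_lt; apply cond_pos).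
  exists (mkposreal _ Hd). intros h h0 Hh. simpl in Hh.
  assert (Hh1 : Rabs h < d1) by (apply Rlt_le_trans with (1 := Hh); apply Rmin_l).
  assert (Hh2 : Rabs h < d2) by (apply Rlt_le_trans with (1 := Hh); apply Rmin_r).
  specialize (H1 h h0 Hh1).
  assert (H3 : Rabs (A (t + h) - A t) < e).
  { apply (H2 (t + h)). change (Rabs (t + h - t) < d2).
    now replace (t + h - t) with h by ring. }
  set (D := (x (t + h) - x t) / h) in *.
  replace ((A (t + h) * (x (t + h) - x t) - A t * (x t - x t)) / h - A t * dx)
    with (A t * (D - dx) + (A (t + h) - A t) * dx + (A (t + h) - A t) * (D - dx))
    by (unfold D; field; exact h0).
  eapply Rle_lt_trans; [apply Rabs_triang|].
  eapply Rle_lt_trans; [apply Rplus_le_compat_r, Rabs_triang|].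
  rewrite !Rabs_mult.
  apply Rlt_le_trans with (e * K).
  - pose proof (Rabs_pos (A t)); pose proof (Rabs_pos dx).
    pose proof (Rabs_pos (D - dx)); pose proof (Rabs_pos (A (t + h) - A t)).
    unfold K. nra.
  - apply Rle_trans with (eps / K * K); [apply Rmult_le_compat_r; lra|].
    right; field; lra.
Qed.

(** Along the curve the increment of [H] is [q (g s) * (g s - g t)]; its real and imaginary parts
    are made of four real products, each a continuous factor times an increment vanishing at [t]. *)
Lemma cdiff_curve (H : C -> C) (g : R -> C) (t : R) (l : C) (dx dy : R) :
  cdiff H (g t) l ->
  is_derive (fun s => Re (g s)) t dx -> is_derive (fun s => Im (g s)) t dy ->
  is_derive (fun s => Re (H (g s))) t (Re (l * (dx, dy))) /\
  is_derive (fun s => Im (H (g s))) t (Im (l * (dx, dy))).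
Proof.
  intros (q & Eq & q0 & Cq) Hx Hy.
  assert (Cg : ccont g t).
  { split; apply (ex_derive_continuous (K := R_AbsRing) (V := R_NormedModule));
      eexists; eassumption. }
  assert (Eg : locally t (fun s => H (g s) - H (g t) = q (g s) * (g s - g t))%C).
  { destruct Eq as [eps Heps].
    destruct Cg as [C1 C2].
    pose proof (proj1 (filterlim_locally _ _) C1 eps) as L1.
    pose proof (proj1 (filterlim_locally _ _) C2 eps) as L2.
    generalize (filter_and _ _ L1 L2); apply filter_imp.
    intros s [B1 B2]. apply Heps. now split. }
  pose proof (ccont_comp g q t Cg Cq) as [Q1 Q2].
  pose proof (is_derive_continuous_mult_sub _ _ _ _ Q1 Hx) as D1.
  pose proof (is_derive_continuous_mult_sub _ _ _ _ Q2 Hy) as D2.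
  pose proof (is_derive_continuous_mult_sub _ _ _ _ Q1 Hy) as D3.
  pose proof (is_derive_continuous_mult_sub _ _ _ _ Q2 Hx) as D4.
  cbv beta in D1, D2, D3, D4. rewrite q0 in D1, D2, D3, D4.
  split.
  - apply is_derive_ext_loc with (fun s => plus (Re (H (g t)))
      (minus (Re (q (g s)) * (Re (g s) - Re (g t)))
             (Im (q (g s)) * (Im (g s) - Im (g t))))).
    + revert Eg; apply filter_imp; intros s E.
      apply (f_equal Re) in E. unfold plus, minus, opp; simpl in *.
      unfold plus, opp, Re, Im in *; simpl in *; lra.
    + evar_last.
      * apply (is_derive_plus (V := R_NormedModule)); [apply is_derive_const|].
        apply (is_derive_minus (V := R_NormedModule)); eassumption.
      * unfold plus, minus, opp, zero; simpl. unfold plus, opp, zero, Re, Im; simpl. ring.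
  - apply is_derive_ext_loc with (fun s => plus (Im (H (g t)))
      (plus (Re (q (g s)) * (Im (g s) - Im (g t)))
             (Im (q (g s)) * (Re (g s) - Re (g t))))).
    + revert Eg; apply filter_imp; intros s E.
      apply (f_equal Im) in E. unfold plus; simpl in *.
      unfold Re, Im in *; simpl in *; lra.
    + evar_last.
      * apply (is_derive_plus (V := R_NormedModule)); [apply is_derive_const|].
        apply (is_derive_plus (V := R_NormedModule)); eassumption.
      * unfold plus, zero; simpl. unfold zero, Re, Im; simpl. ring.
Qed.

(** * Integrals over circles *)

Definition polar (r th : R) : C := (r * cos th, r * sin th).

Lemma Cmod_polar (r th : R) : 0 <= r -> Cmod (polar r th) = r.
Proof.
  intros Hr. unfold Cmod, polar; simpl.
  replace (r * cos th * (r * cos th * 1) + r * sin th * (r * sin th * 1))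
    with (r * r * (Rsqr (sin th) + Rsqr (cos th))) by (unfold Rsqr; ring).
  rewrite sin2_cos2, Rmult_1_r. now apply sqrt_square.
Qed.

Lemma is_derive_polar_radius (r th : R) :
  is_derive (fun s => Re (polar s th)) r (cos th) /\
  is_derive (fun s => Im (polar s th)) r (sin th).
Proof. split; simpl; auto_derive; trivial; ring. Qed.

Lemma is_derive_polar_angle (r th : R) :
  is_derive (fun s => Re (polar r s)) th (- (r * sin th)) /\
  is_derive (fun s => Im (polar r s)) th (r * cos th).
Proof. split; simpl; auto_derive; trivial; ring. Qed.

Lemma ccont_polar_2d (r th : R) :
  ccont (U := prod_UniformSpace R_UniformSpace R_UniformSpace)
    (fun p => polar (fst p) (snd p)) (r, th).
Proof.
  split; simpl.
  - apply (continuous_mult (K := R_AbsRing)); [apply continuous_fst|].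
    apply (continuous_comp snd cos); [apply continuous_snd | apply continuous_cos].
  - apply (continuous_mult (K := R_AbsRing)); [apply continuous_fst|].
    apply (continuous_comp snd sin); [apply continuous_snd | apply continuous_sin].
Qed.

Lemma ccont_polar_angle (r th : R) : ccont (polar r) th.
Proof.
  split; simpl.
  - apply (continuous_mult (K := R_AbsRing)); [apply continuous_const | apply continuous_cos].
  - apply (continuous_mult (K := R_AbsRing)); [apply continuous_const | apply continuous_sin].
Qed.

(** Differentiation under the integral sign asks for a continuous derivative. Building it in avoids
    Goursat's theorem, and the property is stable under all the operations used. *)
Definition C1_on (D : C -> Prop) (H : C -> C) : Prop :=
  exists H' : C -> C, forall z, D z ->
    cdiff H z (H' z) /\ ccont (U := C_UniformSpace) H' z.

Definition punctured_disk (z : C) : Prop := 0 < Cmod z < 1.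

Lemma C1_on_ccont (D : C -> Prop) (H : C -> C) (z : C) :
  C1_on D H -> D z -> ccont (U := C_UniformSpace) H z.
Proof. intros [H' HH] Dz. now apply cdiff_ccont with (H' z), HH. Qed.

Lemma C1_on_const (D : C -> Prop) (c : C) : C1_on D (fun _ => c).
Proof.
  exists (fun _ => RtoC 0); intros z _; split; [apply cdiff_const | apply ccont_const].
Qed.

Lemma C1_on_id (D : C -> Prop) : C1_on D (fun z => z).
Proof.
  exists (fun _ => RtoC 1); intros z _; split; [apply cdiff_id | apply ccont_const].
Qed.

Lemma C1_on_plus (D : C -> Prop) (f g : C -> C) :
  C1_on D f -> C1_on D g -> C1_on D (fun z => f z + g z)%C.
Proof.
  intros [f' Hf] [g' Hg]. exists (fun z => f' z + g' z)%C. intros z Dz.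
  destruct (Hf z Dz), (Hg z Dz). split; [now apply cdiff_plus | now apply ccont_plus].
Qed.

Lemma C1_on_mult (D : C -> Prop) (f g : C -> C) :
  C1_on D f -> C1_on D g -> C1_on D (fun z => f z * g z)%C.
Proof.
  intros [f' Hf] [g' Hg]. exists (fun z => f' z * g z + f z * g' z)%C. intros z Dz.
  destruct (Hf z Dz), (Hg z Dz). split; [now apply cdiff_mult|].
  apply ccont_plus; apply ccont_mult; trivial; eapply cdiff_ccont; eassumption.
Qed.

Lemma C1_on_inv (D : C -> Prop) (g : C -> C) :
  (forall z, D z -> g z <> 0) -> C1_on D g -> C1_on D (fun z => / g z)%C.
Proof.
  intros H0 [g' Hg]. exists (fun z => - (g' z / (g z * g z)))%C. intros z Dz.
  destruct (Hg z Dz) as [H1 H2]. pose proof (cdiff_ccont _ _ _ H1).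
  pose proof (H0 z Dz).
  split; [now apply cdiff_inv|].
  apply ccont_opp, ccont_mult; [assumption|].
  apply ccont_inv; [now apply Cmult_neq_0 | now apply ccont_mult].
Qed.

Lemma C1_on_pow (D : C -> Prop) (g : C -> C) (n : nat) :
  C1_on D g -> C1_on D (fun z => g z ^ n)%C.
Proof.
  intros Hg; induction n as [|n IH]; simpl.
  - apply C1_on_const.
  - now apply C1_on_mult.
Qed.

Definition circle_integral_Re (H : C -> C) (r : R) : R :=
  RInt (fun th => Re (H (polar r th))) 0 (2 * PI).

Lemma continuous_circle (H : C -> C) (r th : R) :
  ccont (U := C_UniformSpace) H (polar r th) ->
  continuous (fun s => Re (H (polar r s))) th.
Proof. intros Hc. now apply (ccont_comp (polar r) H th (ccont_polar_angle r th)). Qed.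

Lemma ex_RInt_circle (H : C -> C) (r : R) :
  C1_on punctured_disk H -> 0 < r < 1 ->
  ex_RInt (fun th => Re (H (polar r th))) 0 (2 * PI).
Proof.
  intros HH Hr.
  apply (ex_RInt_continuous (V := R_CompleteNormedModule)). intros th _.
  apply continuous_circle, C1_on_ccont with (1 := HH).
  red; rewrite Cmod_polar; lra.
Qed.

(* By the Cauchy-Riemann equations the radial derivative of [Re H] is [1/r]
   times the angular derivative of [Im H], whose integral over the circle
   vanishes. *)
Lemma is_derive_circle_integral_Re (H : C -> C) (r : R) :
  C1_on punctured_disk H -> 0 < r < 1 ->
  is_derive (circle_integral_Re H) r 0.
Proof.
  intros HH Hr. pose proof HH as HH0. destruct HH as [H' HH].
  assert (Hp : forall s th, 0 < s < 1 -> punctured_disk (polar s th)).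
  { intros s th Hs. red. rewrite Cmod_polar; lra. }
  assert (Hd : forall s th, 0 < s < 1 ->
     is_derive (fun u => Re (H (polar u th))) s (Re (H' (polar s th) * (cos th, sin th)))).
  { intros s th Hs. destruct (is_derive_polar_radius s th) as [P1 P2].
    now apply (cdiff_curve H (fun u => polar u th) s _ _ _ (proj1 (HH _ (Hp s th Hs)))). }
  assert (Hloc : locally r (fun s => 0 < s < 1)).
  { assert (He : 0 < Rmin r (1 - r)) by (apply Rmin_glb_lt; lra).
    exists (mkposreal _ He). intros s Hs. change (Rabs (s - r) < Rmin r (1 - r)) in Hs.
    pose proof (Rmin_l r (1 - r)). pose proof (Rmin_r r (1 - r)).
    apply Rabs_def2 in Hs. lra. }
  assert (Hc2 : forall th, continuity_2d_pt
            (fun u v => Re (H' (polar u v) * (cos v, sin v))) r th).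
  { intros th. apply continuity_2d_pt_filterlim.
    assert (Q : ccont (U := prod_UniformSpace R_UniformSpace R_UniformSpace)
       (fun p => H' (polar (fst p) (snd p)) * (cos (snd p), sin (snd p)))%C (r, th)).
    { apply ccont_mult.
      - apply (ccont_comp (U := prod_UniformSpace R_UniformSpace R_UniformSpace)
                 (fun p => polar (fst p) (snd p)) H').
        + apply ccont_polar_2d.
        + apply HH, Hp, Hr.
      - split; simpl.
        + apply (continuous_comp snd cos); [apply continuous_snd | apply continuous_cos].
        + apply (continuous_comp snd sin); [apply continuous_snd | apply continuous_sin]. }
    exact (proj1 Q). }
  replace 0 with (RInt (fun th => Derive (fun u => Re (H (polar u th))) r) 0 (2 * PI)).
  - apply (is_derive_RInt_param (fun u th => Re (H (polar u th)))).
    + revert Hloc; apply filter_imp. intros s Hs th _.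
      eexists; now apply Hd.
    + intros th _. apply continuity_2d_pt_ext_loc with (2 := Hc2 th).
      apply locally_2d_locally.
      destruct Hloc as [e He]. exists e. intros [u v] [Hu _].
      symmetry; apply is_derive_unique, Hd, He, Hu.
    + revert Hloc; apply filter_imp. intros s Hs. now apply ex_RInt_circle.
  - rewrite (RInt_ext _ (fun th => Re (H' (polar r th) * (cos th, sin th)))).
    2:{ intros th _. now apply is_derive_unique, Hd. }
    apply is_RInt_unique.
    evar_last.
    + apply (is_RInt_derive (V := R_CompleteNormedModule)
             (fun th => / r * Im (H (polar r th)))).
    * intros th _. destruct (is_derive_polar_angle r th) as [P1 P2].
      pose proof (proj2 (cdiff_curve H (polar r) th _ _ _
                    (proj1 (HH _ (Hp r th Hr))) P1 P2)) as Q.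
      evar_last; [apply (is_derive_scal _ _ (/ r) _ Q)|].
      unfold Re, Im; simpl; field; lra.
    * intros th _.
      assert (Q : ccont (fun v => H' (polar r v) * (cos v, sin v))%C th).
      { apply ccont_mult.
        - apply (ccont_comp (polar r) H' th (ccont_polar_angle r th)), HH, Hp, Hr.
        - split; simpl; [apply continuous_cos | apply continuous_sin]. }
      exact (proj1 Q).
    + unfold polar. rewrite cos_2PI, sin_2PI, cos_0, sin_0.
      unfold minus, plus, opp; simpl; ring.
Qed.

Lemma circle_integral_Re_const (H : C -> C) (r s : R) :
  C1_on punctured_disk H -> 0 < r < 1 -> 0 < s < 1 ->
  circle_integral_Re H r = circle_integral_Re H s.
Proof.
  intros HH Hr Hs.
  assert (W : forall a b, 0 < a -> b < 1 -> a < b ->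
            circle_integral_Re H a = circle_integral_Re H b).
  { intros a b Ha Hb Hab.
    apply (eq_is_derive (V := R_NormedModule)); [|exact Hab].
    intros t Ht. apply is_derive_circle_integral_Re; [exact HH | lra]. }
  destruct (Rtotal_order r s) as [L|[->|L]].
  - apply W; lra.
  - reflexivity.
  - symmetry; apply W; lra.
Qed.

(** * Circle integrals of Laurent polynomials and extraction of coefficients *)

Lemma polar_neq_0 (r th : R) : 0 < r -> polar r th <> 0.
Proof. intros Hr. apply Cmod_gt_0. rewrite Cmod_polar; lra. Qed.

Lemma polar_mult (r s a b : R) : (polar r a * polar s b)%C = polar (r * s) (a + b).
Proof.
  apply injective_projections; simpl; rewrite ?cos_plus, ?sin_plus; ring.
Qed.

Lemma polar_1_0 : polar 1 0 = RtoC 1.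
Proof. unfold polar. rewrite cos_0, sin_0. apply injective_projections; simpl; ring. Qed.

Lemma polar_pow (r th : R) (n : nat) : (polar r th ^ n)%C = polar (r ^ n) (INR n * th).
Proof.
  induction n as [|n IH].
  - simpl. now rewrite Rmult_0_l, polar_1_0.
  - rewrite S_INR. simpl. rewrite IH, polar_mult. f_equal; ring.
Qed.

(** The exponent [S m] makes the frequency a nonzero integer, so there is a trigonometric
    antiderivative and it takes the same value at 0 and [2 * PI]. *)
Lemma is_RInt_circle_negative_power (c : C) (r : R) (m : nat) : 0 < r ->
  is_RInt (fun th => Re (c / polar r th ^ S m)%C) 0 (2 * PI) 0.
Proof.
  intros Hr.
  assert (Hm : 0 < INR (S m)) by (apply lt_0_INR; lia).
  assert (Hrm : 0 < r ^ S m) by now apply pow_lt.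
  apply is_RInt_ext with (fun th =>
    / r ^ S m * (Re c * cos (INR (S m) * th) + Im c * sin (INR (S m) * th))).
  { intros th _. rewrite polar_pow.
    set (R1 := r ^ S m) in *. set (t := INR (S m) * th).
    assert (Hn : polar R1 t <> 0) by now apply polar_neq_0.
    replace (c / polar R1 t)%C with (c * polar (/ R1) (- t))%C.
    - unfold polar. rewrite cos_neg, sin_neg. unfold Re, Im; simpl; ring.
    - replace (polar (/ R1) (- t)) with (/ polar R1 t * (polar R1 t * polar (/ R1) (- t)))%C
        by (field; exact Hn).
      rewrite polar_mult, Rinv_r, Rplus_opp_r by lra.
      rewrite polar_1_0. unfold Cdiv; ring. }
  assert (Hsin : sin (INR (S m) * (2 * PI)) = 0).
  { replace (INR (S m) * (2 * PI)) with (0 + 2 * INR (S m) * PI) by ring.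
    now rewrite sin_period, sin_0. }
  assert (Hcos : cos (INR (S m) * (2 * PI)) = 1).
  { replace (INR (S m) * (2 * PI)) with (0 + 2 * INR (S m) * PI) by ring.
    now rewrite cos_period, cos_0. }
  revert Hm Hrm Hsin Hcos. generalize (INR (S m)) (r ^ S m).
  intros M Q HM HQ Hsin Hcos.
  evar_last.
  - apply (is_RInt_derive (V := R_CompleteNormedModule) (fun th =>
      / Q * / M * (Re c * sin (M * th) - Im c * cos (M * th)))).
    + intros th _. auto_derive; [trivial|]. field. lra.
    + intros th _. apply (ex_derive_continuous (K := R_AbsRing) (V := R_NormedModule)).
      auto_derive. trivial.
  - rewrite Rmult_0_r, Hsin, Hcos, sin_0, cos_0. unfold minus, plus, opp; simpl. ring.
Qed.

Lemma is_RInt_circle_principal_part (e : nat -> C) (r : R) (n k : nat) :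
  0 < r -> (k < n)%nat ->
  is_RInt (fun th => Re (sum_n (fun j => e j * polar r th ^ j)%C k / polar r th ^ n)%C)
    0 (2 * PI) 0.
Proof.
  intros Hr. induction k as [|k IH]; intros Hk.
  - apply is_RInt_ext with (fun th => Re (e 0%nat / polar r th ^ S (n - 1))%C).
    + intros th _. rewrite sum_O. replace (S (n - 1)) with n by lia.
      change (polar r th ^ 0)%C with (RtoC 1). now rewrite Cmult_1_r.
    + now apply is_RInt_circle_negative_power.
  - evar_last.
    + eapply is_RInt_ext.
      2:{ apply (is_RInt_plus (V := R_NormedModule)).
          - apply IH. lia.
          - apply (is_RInt_circle_negative_power (e (S k)) r (n - S k - 1) Hr). }
      intros th _. rewrite sum_Sn.
      pose proof (polar_neq_0 r th Hr) as Hz.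
      set (s := sum_n _ k). set (z := polar r th) in *.
      change (plus s (e (S k) * z ^ S k)%C) with (s + e (S k) * z ^ S k)%C.
      change (Re (s / z ^ n)%C + Re (e (S k) / z ^ S (n - S k - 1))%C
              = Re ((s + e (S k) * z ^ S k) / z ^ n)%C).
      change (Re ((s / z ^ n)%C + (e (S k) / z ^ S (n - S k - 1)))%C
              = Re ((s + e (S k) * z ^ S k) / z ^ n)%C).
      f_equal.
      replace (z ^ n)%C with (z ^ S (n - S k - 1) * z ^ S k)%C.
      * field. split; now apply Cpow_nz.
      * rewrite <- Cpow_add_r. f_equal. lia.
    + unfold plus; simpl; ring.
Qed.

(** After division by [z ^ n] the Taylor polynomial contributes only its top coefficient, and the
    remainder is at most [K s] on the circle of radius [s]. *)
Lemma circle_integral_Re_coef (E : C -> C) (e : nat -> C) (n : nat) (K d r : R) :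
  C1_on punctured_disk E -> 0 < d ->
  (forall z, 0 < Cmod z < d ->
     Cmod (E z - sum_n (fun j => e j * z ^ j)%C n) <= K * Cmod z ^ S n) ->
  0 < r < 1 ->
  circle_integral_Re (fun z => E z / z ^ n)%C r = 2 * PI * Re (e n).
Proof.
  intros HE Hd HK Hr.
  assert (HH : C1_on punctured_disk (fun z => E z / z ^ n)%C).
  { apply (C1_on_mult _ E (fun z => / z ^ n)%C); [exact HE|].
    apply C1_on_inv; [|apply C1_on_pow, C1_on_id].
    intros z Hz. apply Cpow_nz, Cmod_gt_0, Hz. }
  pose proof PI_RGT_0 as Hpi.
  assert (Hsmall : forall s, 0 < s < Rmin d 1 ->
    Rabs (circle_integral_Re (fun z => E z / z ^ n)%C r - 2 * PI * Re (e n))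
      <= 2 * PI * (K * s)).
  { intros s Hs.
    assert (Hs1 : 0 < s < 1) by (pose proof (Rmin_r d 1); lra).
    assert (Hsd : 0 < s < d) by (pose proof (Rmin_l d 1); lra).
    rewrite (circle_integral_Re_const _ r s HH Hr Hs1).
    assert (Hint : is_RInt (fun th => Re (sum_n (fun j => e j * polar s th ^ j)%C n
                      / polar s th ^ n)%C) 0 (2 * PI) (2 * PI * Re (e n))).
    { destruct n as [|n].
      - apply is_RInt_ext with (fun _ => Re (e 0%nat)).
        + intros th _. rewrite sum_O. f_equal. change (polar s th ^ 0)%C with (RtoC 1).
          field.
        + evar_last; [apply (is_RInt_const (V := R_NormedModule))|].
          unfold scal; simpl; unfold mult; simpl; ring.
      - evar_last.
        + eapply is_RInt_ext.
          2:{ apply (is_RInt_plus (V := R_NormedModule)).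
              - apply (is_RInt_circle_principal_part e s (S n) n); [lra | lia].
              - apply (is_RInt_const (V := R_NormedModule) 0 (2 * PI) (Re (e (S n)))). }
          intros th _. rewrite sum_Sn.
          pose proof (polar_neq_0 s th (proj1 Hs)) as Hz.
          set (t := sum_n _ n). set (z := polar s th) in *.
          change (plus t (e (S n) * z ^ S n)%C) with (t + e (S n) * z ^ S n)%C.
          change (Re ((t / z ^ S n)%C + e (S n))%C
                  = Re ((t + e (S n) * z ^ S n) / z ^ S n)%C).
          f_equal. field. now apply Cpow_nz.
        + unfold scal, plus; simpl; unfold mult; simpl; ring. }
    pose proof (RInt_correct (V := R_CompleteNormedModule) _ _ _
                  (ex_RInt_circle _ s HH Hs1)) as Hex.
    pose proof (is_RInt_minus (V := R_NormedModule) _ _ _ _ _ _ Hex Hint) as Hdiff.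
    apply (norm_RInt_le_const (V := R_NormedModule) _ _ _ _ (K * s)) in Hdiff.
    - change (Rabs (circle_integral_Re (fun z => E z / z ^ n)%C s - 2 * PI * Re (e n))
        <= (2 * PI - 0) * (K * s)) in Hdiff. lra.
    - lra.
    - intros th _.
      pose proof (polar_neq_0 s th (proj1 Hs)) as Hz.
      assert (Hm : Cmod (polar s th) = s) by (apply Cmod_polar; lra).
      set (z := polar s th) in *.
      set (t := sum_n _ n).
      change (Rabs (Re ((E z / z ^ n) - t / z ^ n)%C) <= K * s).
      apply Rle_trans with (1 := re_le_Cmod _).
      assert (Hzn : (z ^ n)%C <> 0) by now apply Cpow_nz.
      replace (E z / z ^ n - t / z ^ n)%C with ((E z - t) / z ^ n)%C by (field; exact Hzn).
      rewrite Cmod_div by exact Hzn. rewrite Cmod_pow, Hm.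
      apply Rle_div_l; [apply pow_lt; lra|].
      replace (K * s * s ^ n) with (K * Cmod z ^ S n) by (rewrite Hm; simpl; ring).
      apply HK. rewrite Hm. exact Hsd. }
  apply Rminus_diag_uniq, Rabs_eq_0, Rle_antisym; [|apply Rabs_pos].
  apply Rnot_lt_le. intros Hpos.
  set (D := Rabs _) in *.
  assert (Hm : 0 < Rmin d 1) by (apply Rmin_glb_lt; lra).
  assert (HKa : 0 <= Rabs K) by apply Rabs_pos.
  pose proof (Rle_abs K).
  (* This radius makes the error [2 * PI * (K * s)] at most [D / 2], contradicting [0 < D]. *)
  set (s := Rmin (Rmin d 1 / 2) (D / (4 * PI * (Rabs K + 1)))).
  assert (Hq : 0 < D / (4 * PI * (Rabs K + 1))).
  { apply Rdiv_lt_0_compat; [exact Hpos|]. apply Rmult_lt_0_compat; lra. }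
  assert (0 < s) by (apply Rmin_glb_lt; lra).
  assert (s <= Rmin d 1 / 2) by apply Rmin_l.
  assert (Hs2 : s <= D / (4 * PI * (Rabs K + 1))) by apply Rmin_r.
  assert (Hs : 0 < s < Rmin d 1) by lra.
  specialize (Hsmall s Hs). fold D in Hsmall.
  assert (K * s <= (Rabs K + 1) * (D / (4 * PI * (Rabs K + 1)))).
  { apply Rle_trans with ((Rabs K + 1) * s); [apply Rmult_le_compat_r; lra|].
    apply Rmult_le_compat_l; lra. }
  replace ((Rabs K + 1) * (D / (4 * PI * (Rabs K + 1)))) with (D / (4 * PI)) in * by (field; lra).
  assert (2 * PI * (K * s) <= 2 * PI * (D / (4 * PI))) by (apply Rmult_le_compat_l; lra).
  replace (2 * PI * (D / (4 * PI))) with (D / 2) in * by (field; lra).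
  lra.
Qed.

(** * Local expansions at the origin *)

Definition bigO (n : nat) (f : C -> C) : Prop :=
  exists K d : R, 0 < d /\ forall z, 0 < Cmod z < d -> Cmod (f z) <= K * Cmod z ^ n.

Lemma bigO_ext (n : nat) (f g : C -> C) (d : R) : 0 < d ->
  (forall z, 0 < Cmod z < d -> f z = g z) -> bigO n f -> bigO n g.
Proof.
  intros Hd E (K & d' & Hd' & H). exists K, (Rmin d d'); split.
  - now apply Rmin_glb_lt.
  - intros z Hz. pose proof (Rmin_l d d'). pose proof (Rmin_r d d').
    rewrite <- E by lra. apply H; lra.
Qed.

Lemma bigO_plus (n : nat) (f g : C -> C) :
  bigO n f -> bigO n g -> bigO n (fun z => f z + g z)%C.
Proof.
  intros (K & d & Hd & H) (K' & d' & Hd' & H').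
  exists (K + K'), (Rmin d d'); split; [now apply Rmin_glb_lt|].
  intros z Hz. pose proof (Rmin_l d d'). pose proof (Rmin_r d d').
  apply Rle_trans with (1 := Cmod_triangle _ _).
  rewrite Rmult_plus_distr_r. apply Rplus_le_compat; [apply H | apply H']; lra.
Qed.

Lemma bigO_mult (n m : nat) (f g : C -> C) :
  bigO n f -> bigO m g -> bigO (n + m) (fun z => f z * g z)%C.
Proof.
  intros (K & d & Hd & H) (K' & d' & Hd' & H').
  exists (K * K'), (Rmin d d'); split; [now apply Rmin_glb_lt|].
  intros z Hz. pose proof (Rmin_l d d'). pose proof (Rmin_r d d').
  rewrite Cmod_mult, pow_add.
  replace (K * K' * (Cmod z ^ n * Cmod z ^ m))
    with ((K * Cmod z ^ n) * (K' * Cmod z ^ m)) by ring.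
  apply Rmult_le_compat; try apply Cmod_ge_0; [apply H | apply H']; lra.
Qed.

Lemma bigO_weaken (n m : nat) (f : C -> C) : (m <= n)%nat -> bigO n f -> bigO m f.
Proof.
  intros Hnm (K & d & Hd & H).
  exists K, (Rmin d 1); split; [apply Rmin_glb_lt; lra|].
  intros z Hz. pose proof (Rmin_l d 1). pose proof (Rmin_r d 1).
  assert (Hz' : 0 < Cmod z < d) by lra.
  pose proof (H z Hz') as HK.
  assert (0 < Cmod z ^ n) by (apply pow_lt; lra).
  assert (0 <= K).
  { pose proof (Cmod_ge_0 (f z)). apply Rnot_lt_le; intros Hneg. nra. }
  apply Rle_trans with (1 := HK). apply Rmult_le_compat_l; [assumption|].
  replace n with (m + (n - m))%nat by lia. rewrite pow_add.
  rewrite <- (Rmult_1_r (Cmod z ^ m)) at 2.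
  apply Rmult_le_compat_l; [apply pow_le; lra|].
  rewrite <- (pow1 (n - m)). apply pow_incr; lra.
Qed.

Lemma bigO_const (c : C) : bigO 0 (fun _ => c).
Proof. exists (Cmod c), 1; split; [lra|]. intros z _; simpl; lra. Qed.

Lemma bigO_pow (n : nat) : bigO n (fun z => z ^ n)%C.
Proof. exists 1, 1; split; [lra|]. intros z _. rewrite Cmod_pow; lra. Qed.

Lemma bigO_scal (n : nat) (c : C) (f : C -> C) : bigO n f -> bigO n (fun z => c * f z)%C.
Proof. intros H. exact (bigO_mult 0 n _ _ (bigO_const c) H). Qed.

Lemma bigO_opp (n : nat) (f : C -> C) : bigO n f -> bigO n (fun z => - f z)%C.
Proof. intros (K & d & Hd & H). exists K, d; split; [exact Hd|]. intros z; rewrite Cmod_opp; apply H. Qed.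

Lemma bigO_0_sum (e : nat -> C) (n : nat) : bigO 0 (fun z => sum_n (fun j => e j * z ^ j)%C n).
Proof.
  induction n as [|n IH].
  - apply bigO_ext with (1 := Rlt_0_1) (3 := bigO_const (e 0%nat)).
    intros z _. rewrite sum_O. simpl. now rewrite Cmult_1_r.
  - apply bigO_ext with (1 := Rlt_0_1) (f := fun z => (sum_n (fun j => e j * z ^ j) n + e (S n) * z ^ S n)%C).
    { intros z _. now rewrite sum_Sn. }
    apply bigO_plus; [exact IH|].
    apply bigO_scal, bigO_weaken with (S n); [lia | apply bigO_pow].
Qed.

(** An asymptotic expansion instead of a convergent series: quotients can then be expanded by finite
    algebra. *)
Definition expands (n : nat) (f : C -> C) (e : nat -> C) : Prop :=
  bigO (S n) (fun z => f z - sum_n (fun j => e j * z ^ j) n)%C.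

Lemma expands_pred (n : nat) (f : C -> C) (e : nat -> C) :
  expands (S n) f e -> expands n f e.
Proof.
  intros H. unfold expands.
  apply bigO_ext with (1 := Rlt_0_1) (f := fun z =>
    ((f z - sum_n (fun j => e j * z ^ j) (S n)) + e (S n) * z ^ S n)%C).
  - intros z _. rewrite sum_Sn. set (s := sum_n _ n).
    change (plus s (e (S n) * z ^ S n)%C) with (s + e (S n) * z ^ S n)%C. ring.
  - apply bigO_plus.
    + apply bigO_weaken with (2 := H). lia.
    + apply bigO_scal, bigO_pow.
Qed.

Lemma expands_le (n m : nat) (f : C -> C) (e : nat -> C) :
  (m <= n)%nat -> expands n f e -> expands m f e.
Proof.
  induction n as [|n IH]; intros Hm H.
  - now replace m with 0%nat by lia.
  - destruct (Nat.eq_dec m (S n)) as [->|]; [exact H|].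
    apply IH; [lia | now apply expands_pred].
Qed.

Lemma expands_bounded (n : nat) (f : C -> C) (e : nat -> C) : expands n f e -> bigO 0 f.
Proof.
  intros H. apply bigO_ext with (1 := Rlt_0_1) (f := fun z =>
    ((f z - sum_n (fun j => e j * z ^ j) n) + sum_n (fun j => e j * z ^ j) n)%C).
  - intros z _; ring.
  - apply bigO_plus; [|apply bigO_0_sum].
    apply bigO_weaken with (2 := H). lia.
Qed.

(** The factor [c] lets a real integral see the whole complex coefficient, since the numbers
    [Re (c * e n)] determine [e n]. *)
Lemma circle_integral_Re_taylor (f : C -> C) (e : nat -> C) (c : C) (n : nat) (r : R) :
  C1_on punctured_disk f -> expands n f e -> 0 < r < 1 ->
  circle_integral_Re (fun z => (c * f z) / z ^ n)%C r = 2 * PI * Re (c * e n)%C.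
Proof.
  intros Hf He Hr.
  assert (H : expands n (fun z => c * f z)%C (fun j => c * e j)%C).
  { apply bigO_ext with (1 := Rlt_0_1) (3 := bigO_scal _ c _ He).
    intros z _.
    assert (Hs : sum_n (fun j => c * e j * z ^ j)%C n = (c * sum_n (fun j => e j * z ^ j)%C n)%C).
    { rewrite <- (sum_n_mult_l (K := C_Ring) c). apply sum_n_ext.
      intros j. symmetry. apply Cmult_assoc. }
    rewrite Hs. ring. }
  destruct H as (K & d & Hd & H).
  apply (circle_integral_Re_coef (fun z => c * f z)%C (fun j => c * e j)%C n K d r); trivial.
  apply (C1_on_mult _ (fun _ => c) f); [apply C1_on_const | exact Hf].
Qed.

Lemma circle_integral_Re_positive_power (f : C -> C) (c : C) (n : nat) (r : R) :
  C1_on punctured_disk f -> bigO 0 f -> 0 < r < 1 ->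
  circle_integral_Re (fun z => c * (f z * z ^ S n))%C r = 0.
Proof.
  intros Hf Hb Hr.
  (* A bounded function times [z ^ S n] is O(z), so its expansion of order 0 has constant term 0. *)
  pose proof (circle_integral_Re_taylor (fun z => f z * z ^ S n)%C (fun _ => RtoC 0) c 0 r) as T.
  transitivity (2 * PI * Re (c * 0)%C); [|unfold Re; simpl; ring].
  rewrite <- T.
  - apply RInt_ext. intros th _. f_equal.
    change (polar r th ^ 0)%C with (RtoC 1). field.
  - apply C1_on_mult; [exact Hf | apply C1_on_pow, C1_on_id].
  - apply bigO_ext with (1 := Rlt_0_1) (f := fun z => (f z * z ^ S n)%C).
    + intros z _. rewrite sum_O. ring.
    + apply bigO_weaken with (0 + S n)%nat; [lia|].
      apply bigO_mult; [exact Hb | apply bigO_pow].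
  - exact Hr.
Qed.

(** * Positivity of the Toeplitz form *)

Lemma circle_integral_Re_plus (f g : C -> C) (r : R) :
  C1_on punctured_disk f -> C1_on punctured_disk g -> 0 < r < 1 ->
  circle_integral_Re (fun z => f z + g z)%C r
  = circle_integral_Re f r + circle_integral_Re g r.
Proof.
  intros Hf Hg Hr.
  exact (RInt_plus (V := R_CompleteNormedModule) _ _ _ _
           (ex_RInt_circle f r Hf Hr) (ex_RInt_circle g r Hg Hr)).
Qed.

(** The circles of integration must have radius below 1; the coefficients come with powers of [r],
    which this passage to the limit removes. *)
Lemma nonneg_at_1 (A B1 B2 B3 : R) :
  (forall r, 0 < r < 1 -> 0 <= A + r * B1 + r ^ 2 * B2 + r ^ 3 * B3) ->
  0 <= A + B1 + B2 + B3.
Proof.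
  intros H. apply Rnot_lt_le. intros Hneg.
  (* With [r = 1 - d] one has [1 - r ^ k <= k * d], hence the weights 1, 2, 3. *)
  set (M := Rabs B1 + 2 * Rabs B2 + 3 * Rabs B3 + 1).
  pose proof (Rabs_pos B1) as P1. pose proof (Rabs_pos B2) as P2. pose proof (Rabs_pos B3) as P3.
  set (eta := - (A + B1 + B2 + B3)) in *.
  set (d := Rmin (1 / 2) (eta / (2 * M))).
  assert (HM : 0 < M) by (unfold M; lra).
  assert (He : 0 < eta) by (unfold eta; lra).
  assert (0 < d). { apply Rmin_glb_lt; [lra | apply Rdiv_lt_0_compat; lra]. }
  assert (d <= 1 / 2) by apply Rmin_l.
  assert (Hd2 : d <= eta / (2 * M)) by apply Rmin_r.
  assert (Hr : 0 < 1 - d < 1) by lra.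
  specialize (H _ Hr).
  assert (Q1 : - (d * B1) <= d * Rabs B1).
  { rewrite <- (Rabs_pos_eq d) at 2 by lra. rewrite <- Rabs_mult, <- Rabs_Ropp. apply Rle_abs. }
  assert (Q2 : - ((2 * d - d ^ 2) * B2) <= 2 * d * Rabs B2).
  { apply Rle_trans with ((2 * d - d ^ 2) * Rabs B2); [|apply Rmult_le_compat_r; nra].
    rewrite <- (Rabs_pos_eq (2 * d - d ^ 2)) at 2 by nra.
    rewrite <- Rabs_mult, <- Rabs_Ropp. apply Rle_abs. }
  assert (Q3 : - ((3 * d - 3 * d ^ 2 + d ^ 3) * B3) <= 3 * d * Rabs B3).
  { apply Rle_trans with ((3 * d - 3 * d ^ 2 + d ^ 3) * Rabs B3);
      [|apply Rmult_le_compat_r; nra].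
    rewrite <- (Rabs_pos_eq (3 * d - 3 * d ^ 2 + d ^ 3)) at 2 by nra.
    rewrite <- Rabs_mult, <- Rabs_Ropp. apply Rle_abs. }
  assert (Hlast : d * M <= eta / 2).
  { apply Rle_trans with (eta / (2 * M) * M); [apply Rmult_le_compat_r; lra|].
    right; field; lra. }
  unfold M, eta in *. nra.
Qed.

(** On [|z| = r] the conjugate of [z / r] is [r / z], so [|q|^2] agrees there with a Laurent
    polynomial. Against [p], its positive powers integrate to zero and its power [-k] reads off
    [c k] with a factor [r ^ k]. *)
Lemma caratheodory_toeplitz (p : C -> C) (c : nat -> C) (x0 x1 x2 x3 : C) :
  C1_on punctured_disk p -> (forall z, punctured_disk z -> 0 <= Re (p z)) ->
  expands 3 p c -> c 0%nat = 1 ->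
  0 <= Cmod x0 ^ 2 + Cmod x1 ^ 2 + Cmod x2 ^ 2 + Cmod x3 ^ 2
       + Re (Cconj (x1 * Cconj x0 + x2 * Cconj x1 + x3 * Cconj x2) * c 1%nat)%C
       + Re (Cconj (x2 * Cconj x0 + x3 * Cconj x1) * c 2%nat)%C
       + Re (Cconj (x3 * Cconj x0) * c 3%nat)%C.
Proof.
  intros Hp Hpos Hc Hc0. apply nonneg_at_1. intros r Hr.
  (* Laurent coefficients of [|q|^2] in the variable [z / r]: [D] in degree 0, [d1], [d2], [d3] in
     degrees 1 to 3, and their conjugates in the opposite degrees. *)
  set (D := Cmod x0 ^ 2 + Cmod x1 ^ 2 + Cmod x2 ^ 2 + Cmod x3 ^ 2).
  set (d1 := (x1 * Cconj x0 + x2 * Cconj x1 + x3 * Cconj x2)%C).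
  set (d2 := (x2 * Cconj x0 + x3 * Cconj x1)%C).
  set (d3 := (x3 * Cconj x0)%C).
  set (rc := RtoC r).
  assert (Hrc : rc <> 0) by (intros E; apply (f_equal Re) in E; simpl in E; lra).
  set (T := fun (k : nat) (e : C) z => ((rc ^ k * e * p z) / z ^ k)%C).
  set (N := fun (k : nat) (e : C) z => (e / rc ^ S k * (p z * z ^ S k))%C).
  assert (HT : forall k e, C1_on punctured_disk (T k e)).
  { intros k e. apply (C1_on_mult _ (fun z => rc ^ k * e * p z)%C (fun z => / z ^ k)%C).
    - apply (C1_on_mult _ (fun _ => rc ^ k * e)%C p); [apply C1_on_const | exact Hp].
    - apply C1_on_inv; [|apply C1_on_pow, C1_on_id].
      intros z Hz. apply Cpow_nz, Cmod_gt_0, Hz. }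
  assert (HN : forall k e, C1_on punctured_disk (N k e)).
  { intros k e. apply (C1_on_mult _ (fun _ => e / rc ^ (S k))%C (fun z => p z * z ^ (S k))%C).
    - apply C1_on_const.
    - apply C1_on_mult; [exact Hp | apply C1_on_pow, C1_on_id]. }
  assert (IT : forall k e, (k <= 3)%nat ->
            circle_integral_Re (T k e) r = 2 * PI * (r ^ k * Re (e * c k)%C)).
  { intros k e Hk. unfold T.
    rewrite (circle_integral_Re_taylor p c (rc ^ k * e)%C k r Hp (expands_le 3 k p c Hk Hc) Hr).
    f_equal. unfold rc. rewrite <- RtoC_pow. unfold Re; simpl. ring. }
  assert (IN : forall k e, circle_integral_Re (N k e) r = 0).
  { intros k e. apply circle_integral_Re_positive_power; trivial.
    now apply expands_bounded with 3%nat c. }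
  (* [H] is holomorphic in the whole punctured disk, but equals [p |q|^2] only on the circle of
     radius [r]. *)
  set (H := fun z => (T 0%nat (RtoC D) z + (N 0%nat d1 z + (N 1%nat d2 z + (N 2%nat d3 z
     + (T 1%nat (Cconj d1) z + (T 2%nat (Cconj d2) z + T 3%nat (Cconj d3) z))))))%C).
  assert (HI : circle_integral_Re H r = 2 * PI * (D + r * Re (Cconj d1 * c 1%nat)%C
       + r ^ 2 * Re (Cconj d2 * c 2%nat)%C + r ^ 3 * Re (Cconj d3 * c 3%nat)%C)).
  { unfold H.
    repeat (rewrite circle_integral_Re_plus;
      [| solve [repeat first [apply C1_on_plus | apply HT | apply HN]]
       | solve [repeat first [apply C1_on_plus | apply HT | apply HN]] | exact Hr]).
    rewrite !IN, !IT by lia. rewrite Hc0. unfold Re; simpl. ring. }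
  assert (HC : C1_on punctured_disk H).
  { unfold H. repeat first [apply C1_on_plus | apply HT | apply HN]. }
  assert (0 <= circle_integral_Re H r).
  { pose proof PI_RGT_0.
    apply RInt_ge_0; [lra | now apply ex_RInt_circle|].
    intros th _.
    set (z := polar r th).
    assert (Hz : z <> 0) by (apply polar_neq_0; lra).
    assert (Hzm : Cmod z = r) by (apply Cmod_polar; lra).
    set (q := (x0 + x1 * (z / rc) + x2 * (z / rc) ^ 2 + x3 * (z / rc) ^ 3)%C).
    replace (H z) with (p z * RtoC (Cmod q ^ 2))%C.
    { replace (Re (p z * RtoC (Cmod q ^ 2))%C) with (Re (p z) * Cmod q ^ 2)
        by (unfold Re; simpl; ring).
      apply Rmult_le_pos; [|apply pow2_ge_0].
      apply Hpos. red. lra. }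
    assert (Hzz : (z * Cconj z)%C = (rc * rc)%C).
    { rewrite <- Cmod2_conj, Hzm, RtoC_pow. fold rc. ring. }
    assert (Hbar : Cconj (z / rc)%C = (rc / z)%C).
    { rewrite Cdiv_conj by exact Hrc.
      replace (Cconj rc) with rc by (apply injective_projections; simpl; ring).
      replace (Cconj z) with (z * Cconj z / z)%C by (field; exact Hz).
      rewrite Hzz. field. now split. }
    assert (HD : RtoC D = (x0 * Cconj x0 + x1 * Cconj x1 + x2 * Cconj x2 + x3 * Cconj x3)%C).
    { unfold D. now rewrite !RtoC_plus, !Cmod2_conj. }
    rewrite Cmod2_conj. unfold H, T, N. rewrite HD. unfold d1, d2, d3, q.
    rewrite !Cplus_conj, !Cmult_conj, !Cpow_conj, !Hbar, !Cconj_conj.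
    field. now split. }
  rewrite HI in H0. pose proof PI_RGT_0.
  apply Rmult_le_reg_l with (2 * PI); [lra|]. rewrite Rmult_0_r. exact H0.
Qed.

(** * Power series on the unit disk *)

Lemma is_pseries_C (a : nat -> C) (z l : C) :
  is_pseries (K := C_AbsRing) (V := C_NormedModule) a z l <->
  is_series (V := C_NormedModule) (fun n => a n * z ^ n)%C l.
Proof.
  assert (E : forall n, scal (V := C_NormedModule) (pow_n (K := C_AbsRing) z n) (a n) = (a n * z ^ n)%C).
  { intros n. rewrite Cmult_comm.
    change (scal (V := C_NormedModule) (pow_n (K := C_AbsRing) z n) (a n))
      with (pow_n (K := C_AbsRing) z n * a n)%C.
    reflexivity. }
  split; apply is_series_ext; intros n; now rewrite E.
Qed.

Lemma norm_series_le (t : nat -> C) (b : nat -> R) (l : C) :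
  is_series (V := C_NormedModule) t l -> ex_series b ->
  (forall n, Cmod (t n) <= b n) -> Cmod l <= Series b.
Proof.
  intros Ht Hb Hle. apply Series_correct in Hb.
  assert (Hn : is_lim_seq (fun n => Cmod (sum_n t n)) (Cmod l)).
  { exact (filterlim_comp _ _ _ _ _ _ _ _ Ht (filterlim_norm (V := C_NormedModule) l)). }
  refine (is_lim_seq_le (fun n => Cmod (sum_n t n)) (sum_n b) (Cmod l) (Series b) _ Hn Hb).
  intros n. apply Rle_trans with (1 := norm_sum_n_m (V := C_NormedModule) t 0 n).
  apply sum_n_m_le. intros k. apply Hle.
Qed.

Lemma series_terms_bounded (t : nat -> C) (l : C) :
  is_series (V := C_NormedModule) t l -> exists M, forall n, Cmod (t n) <= M.
Proof.
  intros H.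
  destruct (filterlim_bounded (V := C_NormedModule) (sum_n t)) as [M HM].
  { now exists l. }
  exists (M + M). intros [|n].
  - pose proof (HM 0%nat) as H0. rewrite sum_O in H0.
    change (Cmod (t 0%nat) <= M) in H0. pose proof (Cmod_ge_0 (t 0%nat)). lra.
  - pose proof (HM n) as H0. pose proof (HM (S n)) as H1. rewrite sum_Sn in H1.
    set (s := sum_n t n) in *.
    change (Cmod s <= M) in H0. change (Cmod (s + t (S n))%C <= M) in H1.
    replace (t (S n)) with (s + t (S n) + - s)%C by ring.
    apply Rle_trans with (1 := Cmod_triangle _ _). rewrite Cmod_opp. lra.
Qed.

Definition disk_series (f : C -> C) (a : nat -> C) : Prop :=
  forall z, unit_disk z -> is_pseries (K := C_AbsRing) (V := C_NormedModule) a z (f z).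

(** Passing to moduli brings in the theory of real power series: convergence at a point [s] between
    [r] and 1 bounds [|a n| s^n]. *)
Lemma disk_series_abs_radius (f : C -> C) (a : nat -> C) (r : R) :
  disk_series f a -> 0 <= r < 1 -> Rbar_lt (Rabs r) (CV_radius (fun n => Cmod (a n))).
Proof.
  intros H Hr. rewrite Rabs_pos_eq by lra.
  set (s := (1 + r) / 2).
  apply Rbar_lt_le_trans with s; [simpl; unfold s; lra|].
  apply CV_radius_bounded.
  assert (Hs : unit_disk (RtoC s)).
  { red. rewrite Cmod_R, Rabs_pos_eq; unfold s; lra. }
  pose proof (proj1 (is_pseries_C _ _ _) (H _ Hs)) as Hser.
  destruct (series_terms_bounded _ _ Hser) as [M HM].
  exists M. intros n. specialize (HM n).
  rewrite Cmod_mult, Cmod_pow, Cmod_R in HM.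
  rewrite Rabs_mult, <- RPow_abs, (Rabs_pos_eq (Cmod (a n))) by apply Cmod_ge_0.
  exact HM.
Qed.

Lemma disk_series_abs (f : C -> C) (a : nat -> C) (r : R) :
  disk_series f a -> 0 <= r < 1 -> ex_series (fun n => Cmod (a n) * r ^ n).
Proof.
  intros H Hr.
  apply ex_series_ext with (2 := CV_disk_inside _ _ (disk_series_abs_radius f a r H Hr)).
  intros n. apply Rabs_pos_eq, Rmult_le_pos; [apply Cmod_ge_0 | apply pow_le; lra].
Qed.

Lemma disk_series_derive2_abs (f : C -> C) (a : nat -> C) (r : R) :
  disk_series f a -> 0 <= r < 1 ->
  ex_series (fun n => INR n * INR (n - 1) * Cmod (a n) * r ^ (n - 2)).
Proof.
  intros H Hr. apply (ex_series_incr_n (V := R_NormedModule) _ 2).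
  pose proof (disk_series_abs_radius f a r H Hr) as Hcv.
  rewrite <- CV_radius_derive, <- CV_radius_derive in Hcv.
  apply ex_series_ext with (2 := CV_disk_inside _ _ Hcv).
  intros n. unfold PS_derive.
  replace (2 + n)%nat with (S (S n)) by lia.
  replace (S (S n) - 1)%nat with (S n) by lia. replace (S (S n) - 2)%nat with n by lia.
  rewrite Rabs_pos_eq.
  - match goal with |- @eq _ ?x ?y => change (@eq R x y) end. ring.
  - apply Rmult_le_pos; [|apply pow_le; lra].
    repeat apply Rmult_le_pos; try apply pos_INR. apply Cmod_ge_0.
Qed.

Lemma disk_series_derive_abs (f : C -> C) (a : nat -> C) (r : R) :
  disk_series f a -> 0 <= r < 1 ->
  ex_series (fun n => INR (S n) * Cmod (a (S n)) * r ^ n).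
Proof.
  intros H Hr.
  pose proof (disk_series_abs_radius f a r H Hr) as Hcv.
  rewrite <- CV_radius_derive in Hcv.
  apply ex_series_ext with (2 := CV_disk_inside _ _ Hcv).
  intros n. unfold PS_derive. apply Rabs_pos_eq.
  apply Rmult_le_pos; [|apply pow_le; lra].
  apply Rmult_le_pos; [apply pos_INR | apply Cmod_ge_0].
Qed.

Definition Cseries_derive (a : nat -> C) (n : nat) : C := (INR (S n) * a (S n))%C.

Lemma pow_quadratic_remainder (w z : C) (rho : R) (n : nat) :
  Cmod w <= rho -> Cmod z <= rho ->
  Cmod (w ^ n - z ^ n - INR n * z ^ (n - 1) * (w - z))
    <= INR n * INR (n - 1) * rho ^ (n - 2) * Cmod (w - z) ^ 2.
Proof.
  intros Hw Hz.
  assert (Hrho : 0 <= rho) by (pose proof (Cmod_ge_0 w); lra).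
  assert (Hd : 0 <= Cmod (w - z) ^ 2) by apply pow2_ge_0.
  induction n as [|n IH].
  - simpl. replace (1 - 1 - 0 * 1 * (w - z))%C with (RtoC 0) by ring.
    rewrite Cmod_0. lra.
  - set (A := (w ^ n - z ^ n - INR n * z ^ (n - 1) * (w - z))%C) in *.
    (* The induction rests on this exact recursion between consecutive remainders. *)
    assert (E : (w ^ S n - z ^ S n - INR (S n) * z ^ (S n - 1) * (w - z)
             = w * A + INR n * z ^ (n - 1) * (w - z) ^ 2)%C).
    { unfold A. rewrite S_INR, RtoC_plus. replace (S n - 1)%nat with n by lia.
      destruct n as [|n].
      - simpl. ring.
      - replace (S n - 1)%nat with n by lia. simpl Cpow. ring. }
    rewrite E. apply Rle_trans with (1 := Cmod_triangle _ _).
    rewrite !Cmod_mult, !Cmod_pow, Cmod_R, (Rabs_pos_eq (INR n)) by apply pos_INR.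
    replace (S n - 1)%nat with n by lia.
    replace (S n - 2)%nat with (n - 1)%nat by lia.
    assert (Hp : Cmod z ^ (n - 1) <= rho ^ (n - 1)).
    { apply pow_incr; split; [apply Cmod_ge_0 | exact Hz]. }
    apply Rle_trans with (rho * (INR n * INR (n - 1) * rho ^ (n - 2) * Cmod (w - z) ^ 2)
        + INR n * rho ^ (n - 1) * Cmod (w - z) ^ 2).
    + apply Rplus_le_compat.
      * apply Rmult_le_compat; trivial; apply Cmod_ge_0.
      * apply Rmult_le_compat_r; [exact Hd|]. apply Rmult_le_compat_l; [apply pos_INR | exact Hp].
    + destruct n as [|[|n]].
      * simpl; lra.
      * simpl; lra.
      * replace (S (S n) - 1)%nat with (S n) by lia.
        replace (S (S n) - 2)%nat with n by lia.
        set (d2 := Cmod (w - z) ^ 2) in *.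
        rewrite !S_INR. simpl pow.
        (* The constant propagates because (n+2)(n+1) + (n+2) = (n+2)^2 <= (n+3)(n+2). *)
        replace (rho * ((INR n + 1 + 1) * (INR n + 1) * rho ^ n * d2)
                 + (INR n + 1 + 1) * (rho * rho ^ n) * d2)
          with ((INR n + 1 + 1) * (INR n + 1 + 1) * (rho * rho ^ n) * d2) by ring.
        assert (0 <= rho * rho ^ n) by (apply Rmult_le_pos; [lra | apply pow_le; lra]).
        pose proof (pos_INR n).
        repeat apply Rmult_le_compat_r; nra.
Qed.

(** The quadratic remainders of the monomials are summed term by term on the disk of radius [rho],
    midway between [|z|] and 1, where the second-derivative majorant converges. *)
Lemma disk_series_cdiff (f : C -> C) (a : nat -> C) (z : C) :
  disk_series f a -> unit_disk z ->
  exists l, is_pseries (K := C_AbsRing) (V := C_NormedModule) (Cseries_derive a) z l /\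
            cdiff f z l.
Proof.
  intros H Hz. unfold unit_disk in Hz. pose proof (Cmod_ge_0 z) as Hz0.
  assert (Hex : ex_series (V := C_NormedModule) (fun n => Cseries_derive a n * z ^ n)%C).
  { apply (ex_series_le (V := C_CompleteNormedModule)) with (2 := disk_series_derive_abs f a (Cmod z) H (conj Hz0 Hz)).
    intros n. change (Cmod (Cseries_derive a n * z ^ n) <= INR (S n) * Cmod (a (S n)) * Cmod z ^ n).
    unfold Cseries_derive. rewrite !Cmod_mult, Cmod_pow, Cmod_R, Rabs_pos_eq by apply pos_INR.
    apply Rle_refl. }
  destruct Hex as [l Hl]. exists l. split; [now apply is_pseries_C|].
  set (rho := (1 + Cmod z) / 2).
  assert (Hrho : 0 <= rho < 1) by (unfold rho; lra).
  pose proof (disk_series_derive2_abs f a rho H Hrho) as Hb.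
  set (b := fun n => _) in Hb.
  apply cdiff_quadratic with ((1 - Cmod z) / 2) (Series b); [lra|].
  intros w Hw.
  assert (Hwr : Cmod w <= rho).
  { replace w with ((w - z) + z)%C by ring.
    apply Rle_trans with (1 := Cmod_triangle _ _). unfold rho; lra. }
  (* The derived series is reindexed to match that of [f]; the added term of index 0 is zero. *)
  assert (Hl0 : is_series (V := C_NormedModule) (fun n => INR n * a n * z ^ (n - 1))%C l).
  { set (t := fun n => (INR n * a n * z ^ (n - 1))%C).
    assert (E : plus (G := C_NormedModule) l (opp (sum_n t 0)) = l).
    { rewrite sum_O. unfold t.
      assert (E : forall u v s : C, (u + - (INR 0 * v * s))%C = u) by (intros; simpl; ring).
      apply E. }
    apply (is_series_decr_n (V := C_NormedModule) t 1); [lia|].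
    match goal with |- is_series _ ?u => replace u with l by (symmetry; exact E) end.
    revert Hl. apply is_series_ext. intros n. unfold Cseries_derive, t.
    replace (1 + n)%nat with (S n) by lia. now replace (S n - 1)%nat with n by lia. }
  assert (Hfw : is_series (V := C_NormedModule) (fun n => a n * w ^ n)%C (f w)).
  { apply is_pseries_C, H. red; unfold rho in *; lra. }
  assert (Hfz : is_series (V := C_NormedModule) (fun n => a n * z ^ n)%C (f z)).
  { now apply is_pseries_C, H. }
  pose proof (is_series_minus (V := C_NormedModule) _ _ _ _
    (is_series_minus (V := C_NormedModule) _ _ _ _ Hfw Hfz)
    (is_series_scal (V := C_NormedModule) (w - z)%C _ _ Hl0)) as Hs.
  replace (f w - f z - l * (w - z))%C with (f w - f z - (w - z) * l)%C by ring.
  rewrite Rmult_comm, <- Series_scal_l.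
  refine (norm_series_le _ _ _ Hs _ _).
  - exact (ex_series_scal_l (V := R_NormedModule) (Cmod (w - z) ^ 2) b Hb).
  - intros n.
    change (Cmod (a n * w ^ n - a n * z ^ n - (w - z) * (INR n * a n * z ^ (n - 1)))
            <= Cmod (w - z) ^ 2 * b n).
    replace (a n * w ^ n - a n * z ^ n - (w - z) * (INR n * a n * z ^ (n - 1)))%C
      with (a n * (w ^ n - z ^ n - INR n * z ^ (n - 1) * (w - z)))%C by ring.
    rewrite Cmod_mult. unfold b.
    replace (Cmod (w - z) ^ 2 * (INR n * INR (n - 1) * Cmod (a n) * rho ^ (n - 2)))
      with (Cmod (a n) * (INR n * INR (n - 1) * rho ^ (n - 2) * Cmod (w - z) ^ 2)) by ring.
    apply Rmult_le_compat_l; [apply Cmod_ge_0|].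
    apply pow_quadratic_remainder; [exact Hwr | unfold rho; lra].
Qed.

Lemma disk_series_C_derive (f : C -> C) (a : nat -> C) :
  disk_series f a -> disk_series (C_derive f) (Cseries_derive a).
Proof.
  intros H z Hz. destruct (disk_series_cdiff f a z H Hz) as (l & Hl & Hd).
  now rewrite (cdiff_C_derive _ _ _ Hd).
Qed.

Lemma disk_series_C1 (f : C -> C) (a : nat -> C) :
  disk_series f a -> C1_on unit_disk f.
Proof.
  intros H. exists (C_derive f). intros z Hz.
  assert (G : forall g b, disk_series g b -> cdiff g z (C_derive g z)).
  { intros g b Hg. destruct (disk_series_cdiff g b z Hg Hz) as (l & _ & Hd).
    pose proof (cdiff_C_derive _ _ _ Hd) as E. now subst l. }
  split; [now apply G with a|].
  exact (cdiff_ccont _ _ _ (G _ _ (disk_series_C_derive f a H))).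
Qed.

Lemma disk_series_expands (f : C -> C) (a : nat -> C) (n : nat) :
  disk_series f a -> expands n f a.
Proof.
  intros H.
  assert (Hh : 0 <= 1 / 2 < 1) by lra.
  pose proof (disk_series_abs f a (1 / 2) H Hh) as Hb.
  pose proof (proj1 (ex_series_incr_n (V := R_NormedModule) _ (S n)) Hb) as Hb'.
  cbv beta in Hb'.
  (* The factor [2 ^ S n] cancels the share of [1 / 2] in the powers that are replaced by
     [Cmod z ^ S n]. *)
  set (b := fun k => 2 ^ S n * (Cmod (a (S n + k)%nat) * (1 / 2) ^ (S n + k))).
  assert (Hbs : ex_series b) by exact (ex_series_scal_l (V := R_NormedModule) (2 ^ S n) _ Hb').
  exists (Series b), (1 / 2). split; [lra|]. intros z Hz.
  assert (Hser : is_series (V := C_NormedModule) (fun k => a (S n + k)%nat * z ^ (S n + k))%C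
            (f z - sum_n (fun j => a j * z ^ j) n)%C).
  { apply (is_series_incr_n (V := C_NormedModule) (fun j => a j * z ^ j)%C (S n)); [lia|].
    simpl pred.
    assert (E : forall u v : C, u = (u - v + v)%C) by (intros; ring).
    match goal with |- is_series _ ?u => replace u with (f z) by apply E end.
    apply is_pseries_C, H. red; lra. }
  rewrite Rmult_comm, <- Series_scal_l.
  refine (norm_series_le _ _ _ Hser _ _).
  - exact (ex_series_scal_l (V := R_NormedModule) (Cmod z ^ S n) b Hbs).
  - intros k. unfold b. rewrite Cmod_mult, Cmod_pow, !pow_add.
    replace (Cmod z ^ S n * (2 ^ S n * (Cmod (a (S n + k)%nat) * ((1 / 2) ^ S n * (1 / 2) ^ k))))
      with (Cmod (a (S n + k)%nat) * (Cmod z ^ S n * (1 / 2) ^ k) * (2 ^ S n * (1 / 2) ^ S n)) by ring.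
    rewrite <- Rpow_mult_distr. replace (2 * (1 / 2)) with 1 by field. rewrite pow1, Rmult_1_r.
    apply Rmult_le_compat_l; [apply Cmod_ge_0|].
    apply Rmult_le_compat_l; [apply pow_le; lra|].
    apply pow_incr; lra.
Qed.

(** * Coefficient inequalities *)

(** Positive semidefiniteness of the 4 by 4 Hermitian Toeplitz matrix with diagonal 1 and
    off-diagonals given by [c_k / 2] and their conjugates. *)
Definition toeplitz_nonneg (c1 c2 c3 : C) : Prop :=
  forall x0 x1 x2 x3 : C,
  0 <= Cmod x0 ^ 2 + Cmod x1 ^ 2 + Cmod x2 ^ 2 + Cmod x3 ^ 2
       + Re (Cconj (x1 * Cconj x0 + x2 * Cconj x1 + x3 * Cconj x2) * c1)%C
       + Re (Cconj (x2 * Cconj x0 + x3 * Cconj x1) * c2)%C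
       + Re (Cconj (x3 * Cconj x0) * c3)%C.

Lemma Cconj_RtoC (x : R) : Cconj (RtoC x) = RtoC x.
Proof. apply injective_projections; simpl; ring. Qed.

(** The hypothesis is the form at a vector with two nonzero entries, [|c|] and [-c]; it equals
    [|c|^2 (2 - |c|)]. *)
Lemma Cmod_le_2_of_sqr (c : C) :
  0 <= Cmod c ^ 2 + Cmod c ^ 2 + Re (Cconj (- c * Cconj (Cmod c)) * c)%C -> Cmod c <= 2.
Proof.
  intros H.
  replace (Re (Cconj (- c * Cconj (Cmod c)) * c)%C) with (- (Cmod c * Cmod c ^ 2)) in H.
  - apply Rnot_lt_le. intros Hm.
    assert (0 < Cmod c ^ 2 * (Cmod c - 2)) by (apply Rmult_lt_0_compat; [apply pow_lt|]; lra).
    lra.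
  - rewrite Cmod2_alt. unfold Re, Im; simpl. ring.
Qed.

Lemma toeplitz_nonneg_bound (c1 c2 c3 : C) :
  toeplitz_nonneg c1 c2 c3 -> Cmod c1 <= 2 /\ Cmod c2 <= 2 /\ Cmod c3 <= 2.
Proof.
  intros H.
  assert (E : forall c : C, Cmod (RtoC (Cmod c)) = Cmod c).
  { intros c. rewrite Cmod_R. apply Rabs_pos_eq, Cmod_ge_0. }
  repeat split; apply Cmod_le_2_of_sqr.
  (* Two nonzero entries at distance k isolate the k-th coefficient. *)
  - specialize (H (RtoC (Cmod c1)) (- c1)%C (RtoC 0) (RtoC 0)).
    rewrite E, Cmod_opp, Cmod_0 in H.
    eapply Rle_trans; [exact H|]. right. unfold Re; simpl. ring.
  - specialize (H (RtoC (Cmod c2)) (RtoC 0) (- c2)%C (RtoC 0)).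
    rewrite E, Cmod_opp, Cmod_0 in H.
    eapply Rle_trans; [exact H|]. right. unfold Re; simpl. ring.
  - specialize (H (RtoC (Cmod c3)) (RtoC 0) (RtoC 0) (- c3)%C).
    rewrite E, Cmod_opp, Cmod_0 in H.
    eapply Rle_trans; [exact H|]. right. unfold Re; simpl. ring.
Qed.

(** The lower triangular Toeplitz matrix of b0, b1, b2 has norm at most 1, as for the first Taylor
    coefficients of a function bounded by 1 on the disk. *)
Definition schur_contraction (b0 b1 b2 : C) : Prop :=
  forall s0 s1 s2 : C,
  Cmod (b0 * s0) ^ 2 + Cmod (b1 * s0 + b0 * s1) ^ 2 + Cmod (b2 * s0 + b1 * s1 + b0 * s2) ^ 2
  <= Cmod s0 ^ 2 + Cmod s1 ^ 2 + Cmod s2 ^ 2.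

(* If [p = (1 + z w) / (1 - z w)] with [w = b0 + b1 z + b2 z^2 + ...], the
   Toeplitz form of [p] at the coefficients of [(1 - z w) s] is
   [|s|^2 - |z w s|^2]. *)
Lemma toeplitz_nonneg_schur (b0 b1 b2 : C) :
  toeplitz_nonneg (2 * b0) (2 * (b1 + b0 ^ 2)) (2 * (b2 + 2 * b0 * b1 + b0 ^ 3)) ->
  schur_contraction b0 b1 b2.
Proof.
  intros H s0 s1 s2.
  specialize (H s0 (s1 - b0 * s0) (s2 - b1 * s0 - b0 * s1)
                (- (b2 * s0 + b1 * s1 + b0 * s2)))%C.
  apply Rminus_le_0. eapply Rle_trans; [exact H|]. right.
  apply RtoC_inj.
  rewrite RtoC_minus, !RtoC_plus, !Cmod2_conj, !re_alt.
  repeat rewrite ?Cmult_conj, ?Cplus_conj, ?Cminus_conj, ?Copp_conj, ?Cpow_conj, ?Cconj_conj.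
  rewrite Cconj_RtoC. field.
Qed.

(** For positive [n] this is the discriminant condition [n^2 <= v n c] divided by [n]; for positive
    [v] it is read off at the minimum [t = / v]. *)
Lemma quadratic_discriminant (v n c : R) : 0 <= n -> 0 <= v ->
  (forall t, 0 <= v * n * t ^ 2 - 2 * t * n + c) -> n <= v * c.
Proof.
  intros Hn Hv Hq.
  assert (Hc : 0 <= c) by (specialize (Hq 0); lra).
  destruct (Req_dec n 0) as [->|N0]; [now apply Rmult_le_pos|].
  destruct (Req_dec v 0) as [->|V0].
  - exfalso. specialize (Hq ((c + 1) / n)).
    replace (0 * n * ((c + 1) / n) ^ 2 - 2 * ((c + 1) / n) * n + c)
      with (- c - 2) in Hq by (field; exact N0). lra.
  - specialize (Hq (/ v)).
    replace (v * n * (/ v) ^ 2 - 2 * / v * n + c)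
      with (/ v * (v * c - n)) in Hq by (field; exact V0).
    assert (0 < / v) by (apply Rinv_0_lt_compat; lra).
    apply Rnot_lt_le; intros Hlt.
    assert (0 < / v * (n - v * c)) by (apply Rmult_lt_0_compat; lra). lra.
Qed.

(** These are Schwarz-Pick inequalities. The Schur transform (w - b0) / (z (1 - conj(b0) w)) begins
    with [b1 / u] and [(u b2 + conj(b0) b1^2) / u^2]; applying to it the inequality that bounds [b1]
    gives the last clause. The case [u = 0] is separate because the last clause then says nothing
    about [b2]. *)
Lemma schur_coefficients (b0 b1 b2 : C) :
  schur_contraction b0 b1 b2 ->
  let u := 1 - Cmod b0 ^ 2 in
  0 <= u /\ Cmod b1 <= u /\
  (u = 0 -> b2 = 0) /\
  Cmod (RtoC u * b2 + Cconj b0 * b1 ^ 2) <= u ^ 2 - Cmod b1 ^ 2.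
Proof.
  intros H u.
  assert (Hu : 0 <= u).
  { specialize (H 0 0 1)%C. rewrite !Cmult_0_r, !Cplus_0_l, Cmult_1_r, !Cmod_0, Cmod_1 in H.
    unfold u. lra. }
  pose proof (Cmod_ge_0 b1) as P1. pose proof (Cmod_ge_0 b2) as P2.
  (* If [|b0| = 1], the first component of the image of (1, 0, 0) already has modulus 1 and leaves
     no room for the others. *)
  assert (H0 : u = 0 -> b1 = 0 /\ b2 = 0).
  { intros Eu. specialize (H 1 0 0)%C.
    rewrite !Cmult_0_r, !Cplus_0_r, !Cmult_1_r, !Cmod_0, Cmod_1 in H. unfold u in Eu.
    split; apply Cmod_eq_0; nra. }
  destruct (Req_dec u 0) as [Eu|Nu].
  { destruct (H0 Eu) as [-> ->]. rewrite Eu.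
    replace (0 * 0 + Cconj b0 * 0 ^ 2)%C with (RtoC 0) by ring.
    rewrite Cmod_0. repeat split; lra. }
  assert (Hup : 0 < u) by lra.
  assert (Ec : (b0 * Cconj b0)%C = (1 - RtoC u)%C).
  { rewrite <- Cmod2_conj, <- RtoC_minus. f_equal. unfold u; ring. }
  assert (Hb1 : Cmod b1 <= u).
  (* Since [|b0|^2 = 1 - u], this vector makes the third component of the image collapse to [b1]. *)
  { specialize (H 0 (RtoC u) (Cconj b0 * b1))%C.
    replace (b2 * 0 + b1 * u + b0 * (Cconj b0 * b1))%C with b1 in H.
    2:{ rewrite (Cmult_assoc b0), Ec. ring. }
    rewrite !Cmult_0_r, Cplus_0_l, !Cmod_mult, !Cmod_0, Cmod_conj, Cmod_R, Rabs_pos_eq in H by lra.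
    rewrite !Rpow_mult_distr in H.
    replace (Cmod b0 ^ 2) with (1 - u) in H by (unfold u; ring).
    assert (u * Cmod b1 ^ 2 <= u * u ^ 2) by lra.
    apply Rmult_le_reg_l in H1; [|exact Hup]. nra. }
  split; [exact Hu|]. split; [exact Hb1|]. split; [now intros|].
  set (B := Cmod b1 ^ 2) in *.
  (* With [s0 = u] and [s1 = u * sg], the inequality divided by [u] is a real quadratic in [sg]: [v]
     multiplies [|sg|^2], the linear part is [-2 Re (conj(N) sg)], and [c] is the constant. Taking
     [sg] along [N] is the extremal direction. *)
  set (N := (u * Cconj b0 * b1 + Cconj b1 * b2)%C).
  set (v := u ^ 2 - B).
  set (c := u ^ 2 - u * B - Cmod b2 ^ 2).
  assert (Hv : 0 <= v) by (unfold v, B; nra).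
  (* [s2] is the optimal choice for given [s0 = u] and [s1 = u t N]; varying [t]
     turns the contraction inequality into a discriminant condition. *)
  assert (Hq : forall t : R, 0 <= v * Cmod N ^ 2 * t ^ 2 - 2 * t * Cmod N ^ 2 + c).
  { intros t. set (sg := (t * N)%C).
    specialize (H (RtoC u) (u * sg) (Cconj b0 * (b2 + b1 * sg)))%C.
    replace (b2 * u + b1 * (u * sg) + b0 * (Cconj b0 * (b2 + b1 * sg)))%C
      with (b2 + b1 * sg)%C in H.
    2:{ rewrite (Cmult_assoc b0), Ec. ring. }
    replace (b1 * u + b0 * (u * sg))%C with (u * (b1 + b0 * sg))%C in H by ring.
    rewrite !(Cmod_mult _ (RtoC u)), !(Cmod_mult (RtoC u)), (Cmod_mult (Cconj b0)),
      Cmod_conj, Cmod_R, Rabs_pos_eq, !Rpow_mult_distr in H by lra.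
    replace (Cmod b0 ^ 2) with (1 - u) in H by (unfold u; ring).
    assert (H1 : u * 0 <= u * (u + u * Cmod sg ^ 2 - u * (1 - u) - u * Cmod (b1 + b0 * sg) ^ 2
              - Cmod (b2 + b1 * sg) ^ 2)) by lra.
    apply Rmult_le_reg_l in H1; [|exact Hup].
    eapply Rle_trans; [exact H1|]. right.
    unfold c, v, B, sg, N.
    apply RtoC_inj.
    repeat rewrite ?RtoC_minus, ?RtoC_plus, ?RtoC_mult, ?Cmod2_conj.
    rewrite !RtoC_pow.
    repeat rewrite ?Cmult_conj, ?Cplus_conj, ?Cminus_conj, ?Copp_conj, ?Cpow_conj, ?Cconj_conj,
      ?Cconj_RtoC.
    ring [Ec]. }
  assert (HN : Cmod N ^ 2 <= v * c).
  { apply quadratic_discriminant; [apply pow2_ge_0 | exact Hv | exact Hq]. }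
  (* An identity, valid because [|b0|^2 = 1 - u]; the discriminant condition says that the bracket
     is nonnegative. *)
  assert (HM : Cmod (u * b2 + Cconj b0 * b1 ^ 2) ^ 2 = v * v - (v * c - Cmod N ^ 2)).
  { unfold c, v, B, N. apply RtoC_inj.
    repeat rewrite ?RtoC_minus, ?RtoC_plus, ?RtoC_mult, ?Cmod2_conj.
    rewrite !RtoC_pow.
    repeat rewrite ?Cmult_conj, ?Cplus_conj, ?Cminus_conj, ?Copp_conj, ?Cpow_conj, ?Cconj_conj,
      ?Cconj_RtoC.
    ring [Ec]. }
  apply Rsqr_incr_0_var; [|exact Hv]. rewrite !Rsqr_pow2. lra.
Qed.

(** For the Schur function of a convex map this expression is 18 times the Hankel determinant. The
    bound found in terms of [s = |b0|] and [y = |b1|] is largest at [y = u], where it is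
    [(1 - s^2) (2 + 4 s^2)], with maximum 9/4 at [s = 1/2]. *)
Lemma schur_hankel_bound (b0 b1 b2 : C) :
  schur_contraction b0 b1 b2 ->
  Cmod (3 * b0 * b2 + 3 * b0 ^ 2 * b1 - 2 * b1 ^ 2) <= 9 / 4.
Proof.
  intros H. destruct (schur_coefficients b0 b1 b2 H) as (Hu & Hb1 & Hb2 & HM).
  revert Hu Hb1 Hb2 HM. set (u := 1 - Cmod b0 ^ 2). intros Hu Hb1 Hb2 HM.
  pose proof (Cmod_ge_0 b0) as P0. pose proof (Cmod_ge_0 b1) as P1.
  destruct (Req_dec u 0) as [Eu|Nu].
  { rewrite (Hb2 Eu). rewrite Eu in Hb1.
    rewrite (Cmod_eq_0 b1) by lra.
    replace (3 * b0 * 0 + 3 * b0 ^ 2 * 0 - 2 * 0 ^ 2)%C with (RtoC 0) by ring.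
    rewrite Cmod_0. lra. }
  set (M := (u * b2 + Cconj b0 * b1 ^ 2)%C) in *.
  set (s := Cmod b0) in *. set (y := Cmod b1) in *.
  assert (Ec : (b0 * Cconj b0)%C = (1 - RtoC u)%C).
  { rewrite <- Cmod2_conj, <- RtoC_minus. f_equal. unfold u, s; ring. }
  (* Multiplying by [u] allows [b2] to be eliminated in favour of [M], whose modulus is
     controlled. *)
  assert (E : (u * (3 * b0 * b2 + 3 * b0 ^ 2 * b1 - 2 * b1 ^ 2)
     = 3 * b0 * M + 3 * u * b0 ^ 2 * b1 + - ((3 * (1 - u) + 2 * u) * b1 ^ 2))%C).
  { unfold M. ring [Ec]. }
  apply (f_equal Cmod) in E.
  rewrite Cmod_mult, Cmod_R, Rabs_pos_eq in E by lra.
  set (X := Cmod (3 * b0 * b2 + 3 * b0 ^ 2 * b1 - 2 * b1 ^ 2)) in *.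
  assert (HX : u * X <= 3 * s * (u ^ 2 - y ^ 2) + 3 * u * s ^ 2 * y
                        + (3 * (1 - u) + 2 * u) * y ^ 2).
  { rewrite E. apply Rle_trans with (1 := Cmod_triangle _ _).
    apply Rplus_le_compat.
    - apply Rle_trans with (1 := Cmod_triangle _ _). apply Rplus_le_compat.
      + rewrite !Cmod_mult, Cmod_R, (Rabs_pos_eq 3) by lra. fold s.
        apply Rmult_le_compat_l; [lra | exact HM].
      + rewrite !Cmod_mult, Cmod_pow, !Cmod_R, (Rabs_pos_eq 3), (Rabs_pos_eq u) by lra.
        fold s y. right; ring.
    - rewrite Cmod_opp, Cmod_mult, Cmod_pow. fold y.
      rewrite <- !RtoC_minus, <- !RtoC_mult, <- RtoC_plus, Cmod_R, Rabs_pos_eq; [lra|].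
      assert (u <= 1) by (unfold u; nra). lra. }
  assert (Hs : 0 <= s <= 1) by (unfold u in Hu; nra).
  assert (HX2 : u * X <= u * (u * (2 + 4 * s ^ 2))).
  { eapply Rle_trans; [exact HX|].
    assert (Q1 : y ^ 2 <= u ^ 2) by nra.
    (* The factor is [(2 + s^2) - 3 s], the net coefficient of [y^2]; its sign is what allows [y] to
       be replaced by [u]. *)
    assert (Q2 : 0 <= (1 - s) * (2 - s) * (u ^ 2 - y ^ 2)).
    { apply Rmult_le_pos; [apply Rmult_le_pos|]; lra. }
    assert (Q3 : 0 <= 3 * u * s ^ 2 * (u - y)).
    { apply Rmult_le_pos; [apply Rmult_le_pos|]; nra. }
    replace (3 * (1 - u) + 2 * u) with (2 + s ^ 2) by (unfold u; ring). nra. }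
  apply Rmult_le_reg_l in HX2; [|lra].
  eapply Rle_trans; [exact HX2|]. unfold u.
  (* [(1 - s^2) (2 + 4 s^2)] equals 9/4 minus this square. *)
  pose proof (pow2_ge_0 (2 * s ^ 2 - 1 / 2)). nra.
Qed.

(** * Bounds for convex functions and for the Hankel determinant *)

Lemma Cmod_plus_le (w z : C) (A B : R) :
  Cmod w <= A -> Cmod z <= B -> Cmod (w + z) <= A + B.
Proof. intros; apply Rle_trans with (1 := Cmod_triangle _ _); lra. Qed.

Lemma Cmod_mult_le (w z : C) (A B : R) :
  Cmod w <= A -> Cmod z <= B -> Cmod (w * z) <= A * B.
Proof.
  intros. rewrite Cmod_mult. apply Rmult_le_compat; trivial; apply Cmod_ge_0.
Qed.

Lemma Cmod_opp_le (z : C) (A : R) : Cmod z <= A -> Cmod (- z) <= A.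
Proof. now rewrite Cmod_opp. Qed.

Lemma Cmod_real_le (k : R) : 0 <= k -> Cmod (RtoC k) <= k.
Proof. intros. rewrite Cmod_R, Rabs_pos_eq; lra. Qed.

Lemma Cmod_scal_le_reg (k : R) (z : C) (A : R) :
  0 < k -> Cmod (k * z) <= k * A -> Cmod z <= A.
Proof.
  intros Hk. rewrite Cmod_mult, Cmod_R, Rabs_pos_eq by lra. now apply Rmult_le_reg_l.
Qed.

Ltac bound_Cmod :=
  repeat first [ eassumption | apply Cmod_plus_le | apply Cmod_mult_le
               | apply Cmod_opp_le | apply Cmod_real_le; lra ].

Lemma convex_coefficient_bounds (c2 c3 c4 : C) :
  toeplitz_nonneg (2 * c2) (6 * c3 - 4 * c2 ^ 2) (12 * c4 - 18 * c2 * c3 + 8 * c2 ^ 3) ->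
  Cmod c2 <= 1 /\ Cmod c3 <= 1 /\ Cmod c4 <= 1 /\
  Cmod (4 * c3 - 3 * c2 ^ 2) <= 4 / 3 /\ Cmod (c2 * c4 - c3 ^ 2) <= 1 / 8.
Proof.
  intros HT.
  destruct (toeplitz_nonneg_bound _ _ _ HT) as (B1 & B2 & B3).
  (* With b0 = [c2], these solve P = (1 + z w) / (1 - z w) for w. *)
  set (b1 := (3 * c3 - 3 * c2 ^ 2)%C).
  set (b2 := (6 * c4 - 15 * c2 * c3 + 9 * c2 ^ 3)%C).
  assert (HS : schur_contraction c2 b1 b2).
  { apply toeplitz_nonneg_schur.
    replace (2 * (b1 + c2 ^ 2))%C with (6 * c3 - 4 * c2 ^ 2)%C by (unfold b1; ring).
    replace (2 * (b2 + 2 * c2 * b1 + c2 ^ 3))%C with (12 * c4 - 18 * c2 * c3 + 8 * c2 ^ 3)%C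
      by (unfold b1, b2; ring).
    exact HT. }
  pose proof (schur_hankel_bound _ _ _ HS) as HH.
  destruct (schur_coefficients _ _ _ HS) as (_ & Hb & _).
  assert (H2 : Cmod c2 <= 1).
  { apply (Cmod_scal_le_reg 2); lra. }
  assert (Hsq : Cmod (c2 * c2) <= Cmod c2 ^ 2) by (rewrite Cmod_mult; lra).
  assert (Hs1 : Cmod c2 ^ 2 <= 1) by (pose proof (Cmod_ge_0 c2); nra).
  pose proof (pow2_ge_0 (Cmod c2)) as Hs0.
  assert (Hsq1 : Cmod (c2 * c2) <= 1) by lra.
  split; [exact H2|]. split; [|split; [|split]].
  - apply (Cmod_scal_le_reg 3); [lra|].
    replace (3 * c3)%C with (b1 + 3 * (c2 * c2))%C by (unfold b1; ring).
    eapply Rle_trans; [apply Cmod_plus_le; [exact Hb | apply Cmod_mult_le;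
      [apply Cmod_real_le; lra | exact Hsq]]|]. lra.
  - apply (Cmod_scal_le_reg 12); [lra|].
    (* Regrouped around the coefficients of P, each at most 2 in modulus: 2 + 3 * 2 + 4 = 12. *)
    replace (12 * c4)%C with ((12 * c4 - 18 * c2 * c3 + 8 * c2 ^ 3)
       + (3 * (c2 * (6 * c3 - 4 * c2 ^ 2)) + 4 * (c2 * (c2 * c2))))%C by ring.
    eapply Rle_trans; [bound_Cmod|]. lra.
  - apply (Cmod_scal_le_reg 3); [lra|].
    replace (3 * (4 * c3 - 3 * c2 ^ 2))%C with (4 * b1 + 3 * (c2 * c2))%C by (unfold b1; ring).
    eapply Rle_trans; [apply Cmod_plus_le; apply Cmod_mult_le;
      [apply Cmod_real_le; lra | exact Hb | apply Cmod_real_le; lra | exact Hsq]|]. lra.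
  - apply (Cmod_scal_le_reg 18); [lra|].
    replace (18 * (c2 * c4 - c3 ^ 2))%C
      with (3 * c2 * b2 + 3 * c2 ^ 2 * b1 - 2 * b1 ^ 2)%C by (unfold b1, b2; ring).
    lra.
Qed.

(* The coefficients of [phi] are [c], those of [(f' / phi' - beta) / t] are [p],
   with [t = 1 - beta]. *)
Lemma hankel_bound_of_coefficients (t : R) (c2 c3 c4 p1 p2 p3 a2 a3 a4 : C) :
  0 < t ->
  toeplitz_nonneg (2 * c2) (6 * c3 - 4 * c2 ^ 2) (12 * c4 - 18 * c2 * c3 + 8 * c2 ^ 3) ->
  toeplitz_nonneg p1 p2 p3 ->
  (2 * a2 = 2 * c2 + t * p1)%C ->
  (3 * a3 = 3 * c3 + t * (2 * c2 * p1 + p2))%C ->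
  (4 * a4 = 4 * c4 + t * (3 * c3 * p1 + 2 * c2 * p2 + p3))%C ->
  Cmod (a2 * a4 - a3 ^ 2) <= 1 / 8 + 28 / 9 * t + 5 * t ^ 2.
Proof.
  intros Ht HT Hp E2 E3 E4.
  destruct (toeplitz_nonneg_bound _ _ _ Hp) as (B1 & B2 & B3).
  destruct (convex_coefficient_bounds _ _ _ HT) as (C2 & C3 & C4 & FS & HH).
  set (fs := (4 * c3 - 3 * c2 ^ 2)%C) in *. set (hk := (c2 * c4 - c3 ^ 2)%C) in *.
  assert (Ht0 : Cmod (RtoC t) <= t) by (apply Cmod_real_le; lra).
  apply (Cmod_scal_le_reg 72); [lra|].
  replace (72 * (a2 * a4 - a3 ^ 2))%C
    with (9 * (2 * a2) * (4 * a4) - 8 * (3 * a3) ^ 2)%C by ring.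
  rewrite E2, E3, E4.
  (* The grouping decides the constants. Collecting the factor of [p2] into [fs] gives 72 + 84 + 32
     + 36 = 224 = 72 * 28/9 in degree 1; degree 2 gives 4 (27 + 14 + 9 + 32 + 8) = 360 = 72 * 5. *)
  replace (9 * (2 * c2 + t * p1) * (4 * c4 + t * (3 * c3 * p1 + 2 * c2 * p2 + p3))
           - 8 * (3 * c3 + t * (2 * c2 * p1 + p2)) ^ 2)%C
    with (72 * hk
      + t * (36 * (c4 * p1) + - (42 * (c2 * (c3 * p1))) + - (12 * (fs * p2)) + 18 * (c2 * p3))
      + t * (t * (27 * (c3 * (p1 * p1)) + - (14 * (c2 * (p1 * p2))) + 9 * (p1 * p3)
                  + - (32 * (c2 * (c2 * (p1 * p1)))) + - (8 * (p2 * p2)))))%C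
    by (unfold hk, fs; ring).
  eapply Rle_trans; [bound_Cmod|]. lra.
Qed.

(** * Expansions of quotients and their Toeplitz forms *)

Lemma sum_n_2 (e : nat -> C) (z : C) :
  sum_n (fun j => e j * z ^ j)%C 2 = (e 0%nat + e 1%nat * z + e 2%nat * z ^ 2)%C.
Proof.
  rewrite !sum_Sn, sum_O.
  change (e 0%nat * z ^ 0 + e 1%nat * z ^ 1 + e 2%nat * z ^ 2
   = e 0%nat + e 1%nat * z + e 2%nat * z ^ 2)%C.
  simpl. ring.
Qed.

Lemma sum_n_3 (e : nat -> C) (z : C) :
  sum_n (fun j => e j * z ^ j)%C 3
  = (e 0%nat + e 1%nat * z + e 2%nat * z ^ 2 + e 3%nat * z ^ 3)%C.
Proof. rewrite sum_Sn, sum_n_2. reflexivity. Qed.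

Lemma bigO_inv (n : nat) (g : C -> C) (v : nat -> C) :
  expands n g v -> v 0%nat = 1 ->
  bigO 0 (fun z => / g z)%C /\ exists d, 0 < d /\ forall z, 0 < Cmod z < d -> g z <> 0.
Proof.
  intros Hg Hv. apply (expands_le n 0) in Hg; [|lia].
  destruct Hg as (K & d & Hd & H).
  set (e := Rmin d (1 / (2 * (Rabs K + 1)))).
  pose proof (Rabs_pos K) as HK. pose proof (Rle_abs K) as HK'.
  assert (He : 0 < e).
  { apply Rmin_glb_lt; [exact Hd | apply Rdiv_lt_0_compat; lra]. }
  assert (Hlow : forall z, 0 < Cmod z < e -> 1 / 2 <= Cmod (g z)).
  { intros z Hz.
    assert (e <= d) by apply Rmin_l.
    assert (He2 : e <= 1 / (2 * (Rabs K + 1))) by apply Rmin_r.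
    assert (Hz' : 0 < Cmod z < d) by lra.
    specialize (H z Hz'). rewrite sum_O, Hv in H.
    replace (1 * z ^ 0)%C with (RtoC 1) in H by (change (z ^ 0)%C with (RtoC 1); ring).
    rewrite pow_1 in H.
    assert (K * Cmod z <= (Rabs K + 1) * (1 / (2 * (Rabs K + 1)))).
    { apply Rle_trans with ((Rabs K + 1) * Cmod z); [apply Rmult_le_compat_r; lra|].
      apply Rmult_le_compat_l; lra. }
    replace ((Rabs K + 1) * (1 / (2 * (Rabs K + 1)))) with (1 / 2) in * by (field; lra).
    assert (1 <= Cmod (g z) + 1 / 2); [|lra].
    rewrite <- Cmod_1 at 1.
    replace (RtoC 1) with (g z + - (g z - 1))%C by ring.
    apply Cmod_plus_le; [lra | apply Cmod_opp_le; lra]. }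
  assert (Hn : forall z, 0 < Cmod z < e -> g z <> 0).
  { intros z Hz E. specialize (Hlow z Hz). rewrite E, Cmod_0 in Hlow. lra. }
  split; [|now exists e].
  exists 2, e. split; [exact He|]. intros z Hz.
  rewrite Cmod_inv by now apply Hn.
  specialize (Hlow z Hz). simpl. rewrite Rmult_1_r.
  replace 2 with (/ (1 / 2)) by field. apply Rinv_le_contravar; lra.
Qed.

(** The hypotheses on [u] say that [c] is the formal quotient through degree 3. Then f - g P is a
    combination of the two remainders and of the overflow of the product of truncations, all O(z^4),
    and [/ g] is bounded near 0. *)
Lemma expands_div (f g : C -> C) (u v c : nat -> C) :
  expands 3 f u -> expands 3 g v -> v 0%nat = 1 ->
  u 0%nat = c 0%nat ->
  u 1%nat = (c 1%nat + v 1%nat * c 0%nat)%C ->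
  u 2%nat = (c 2%nat + v 1%nat * c 1%nat + v 2%nat * c 0%nat)%C ->
  u 3%nat = (c 3%nat + v 1%nat * c 2%nat + v 2%nat * c 1%nat + v 3%nat * c 0%nat)%C ->
  expands 3 (fun z => f z / g z)%C c.
Proof.
  intros Hf Hg Hv E0 E1 E2 E3.
  destruct (bigO_inv 3 g v Hg Hv) as [Hi (d & Hd & Hn)].
  set (P := fun z => sum_n (fun j => c j * z ^ j)%C 3).
  (* [z ^ 4 * W z] is the part of degrees 4 to 6 in the product of the truncations of [g] and of the
     quotient. *)
  set (W := fun z => ((v 1%nat * c 3%nat + v 2%nat * c 2%nat + v 3%nat * c 1%nat)
     + ((v 2%nat * c 3%nat + v 3%nat * c 2%nat) * z ^ 1 + v 3%nat * c 3%nat * z ^ 2))%C).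
  apply bigO_ext with (d := d) (f := fun z =>
    (((f z - sum_n (fun j => u j * z ^ j) 3)
      + (- ((g z - sum_n (fun j => v j * z ^ j) 3) * P z) + - (z ^ 4 * W z))) * / g z)%C);
    [exact Hd| |].
  - intros z Hz. unfold P, W. rewrite !sum_n_3, E0, E1, E2, E3, Hv.
    field. now apply Hn.
  - apply (bigO_mult 4 0); [|exact Hi].
    apply bigO_plus; [exact Hf|]. apply bigO_plus; apply bigO_opp.
    + apply (bigO_mult 4 0); [exact Hg | apply bigO_0_sum].
    + apply (bigO_mult 4 0); [apply bigO_pow|].
      apply bigO_plus; [apply bigO_const|].
      apply bigO_plus; apply bigO_scal;
        [apply bigO_weaken with 1%nat | apply bigO_weaken with 2%nat]; try lia; apply bigO_pow.
Qed.

Lemma C1_on_subset (D D' : C -> Prop) (f : C -> C) :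
  (forall z, D' z -> D z) -> C1_on D f -> C1_on D' f.
Proof. intros HD [f' H]. exists f'. intros z Hz. apply H, HD, Hz. Qed.

Lemma caratheodory_quotient (f g : C -> C) (u v : nat -> C) (c1 c2 c3 : C) :
  C1_on unit_disk f -> C1_on unit_disk g ->
  (forall z, unit_disk z -> g z <> 0) ->
  (forall z, unit_disk z -> 0 <= Re (f z / g z)%C) ->
  expands 3 f u -> expands 3 g v -> v 0%nat = 1 ->
  u 0%nat = 1 ->
  u 1%nat = (c1 + v 1%nat)%C ->
  u 2%nat = (c2 + v 1%nat * c1 + v 2%nat)%C ->
  u 3%nat = (c3 + v 1%nat * c2 + v 2%nat * c1 + v 3%nat)%C ->
  toeplitz_nonneg c1 c2 c3.
Proof.
  intros Hf Hg Hn Hpos Ef Eg Hv E0 E1 E2 E3.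
  set (c := fun n : nat => match n with
     | 0 => RtoC 1 | 1 => c1 | 2 => c2 | _ => c3 end%nat).
  intros x0 x1 x2 x3.
  apply (caratheodory_toeplitz (fun z => f z / g z)%C c).
  - apply C1_on_subset with unit_disk; [intros z Hz; apply Hz|].
    apply (C1_on_mult _ f (fun z => / g z)%C); [exact Hf|].
    now apply C1_on_inv.
  - intros z Hz. apply Hpos, Hz.
  - apply expands_div with u v; trivial; unfold c; rewrite ?Cmult_1_r; assumption.
  - reflexivity.
Qed.

(** The convexity quotient is [(z phi')' / phi'], whose numerator has coefficients (n+1)^2 c_(n+1);
    the three entries come from formal division by [phi']. *)
Lemma convex_toeplitz (phi : C -> C) (c : nat -> C) :
  disk_series phi c -> c 1%nat = 1 ->
  (forall z, unit_disk z -> C_derive phi z <> 0) ->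
  (forall z, unit_disk z ->
     0 < Re (1 + z * C_derive (C_derive phi) z / C_derive phi z)%C) ->
  toeplitz_nonneg (2 * c 2%nat) (6 * c 3%nat - 4 * c 2%nat ^ 2)
    (12 * c 4%nat - 18 * c 2%nat * c 3%nat + 8 * c 2%nat ^ 3).
Proof.
  intros Hc Hc1 Hn Hpos.
  pose proof (disk_series_C_derive _ _ Hc) as H1.
  pose proof (disk_series_C_derive _ _ H1) as H2.
  apply caratheodory_quotient with
    (f := fun z => (C_derive phi z + z * C_derive (C_derive phi) z)%C)
    (g := C_derive phi)
    (u := fun n => (INR (S n) * (INR (S n) * c (S n)))%C)
    (v := Cseries_derive c).
  - apply C1_on_plus; [now apply disk_series_C1 with (Cseries_derive c)|].
    apply C1_on_mult; [apply C1_on_id|].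
    now apply disk_series_C1 with (Cseries_derive (Cseries_derive c)).
  - now apply disk_series_C1 with (Cseries_derive c).
  - exact Hn.
  - intros z Hz. apply Rlt_le.
    replace ((C_derive phi z + z * C_derive (C_derive phi) z) / C_derive phi z)%C
      with (1 + z * C_derive (C_derive phi) z / C_derive phi z)%C
      by (field; now apply Hn).
    now apply Hpos.
  (* Order 2 is enough for [phi''], which is multiplied by [z]. *)
  - pose proof (disk_series_expands _ _ 3 H1) as X1.
    pose proof (disk_series_expands _ _ 2 H2) as X2.
    apply bigO_ext with (1 := Rlt_0_1) (f := fun z =>
      ((C_derive phi z - sum_n (fun j => Cseries_derive c j * z ^ j) 3)
       + z ^ 1 * (C_derive (C_derive phi) z
            - sum_n (fun j => Cseries_derive (Cseries_derive c) j * z ^ j) 2))%C).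
    + intros z _. rewrite !sum_n_3, sum_n_2. unfold Cseries_derive. simpl.
      rewrite !RtoC_plus. ring.
    + apply bigO_plus; [exact X1|].
      apply (bigO_mult 1 3); [apply bigO_pow | exact X2].
  - now apply disk_series_expands.
  - unfold Cseries_derive. simpl. rewrite Hc1. ring.
  - simpl. rewrite Hc1. ring.
  - unfold Cseries_derive. simpl. rewrite !RtoC_plus. ring.
  - unfold Cseries_derive. simpl. rewrite !RtoC_plus. ring.
  - unfold Cseries_derive. simpl. rewrite !RtoC_plus. ring.
Qed.

Theorem theorem2p2 (beta : R) (hbeta : 0 <= beta < 1)
  (f : C -> C) (a : nat -> C)
  (hf : class_K_Sigma beta f) (ha : normalized_expansion f a) :
  Cmod (a 2%nat * a 4%nat - a 3%nat ^ 2)%C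
  <= 1 / 8 + 19 / 6 * (1 - beta) + 6 * (1 - beta) ^ 2
     + 4 * (1 - beta) ^ 3 + (1 - beta) ^ 4.
Proof.
  destruct hf as (_ & g & phi & psi & _ & [_ [HCV _]] & _ & _ & Hre & _).
  destruct HCV as [[_ [_ [c (_ & Hc1 & Hc)]]] HP].
  destruct ha as (_ & Ha1 & Ha).
  (* Division by zero gives 0, which [beta < Re (f' / phi')] excludes. *)
  assert (Hn : forall z, unit_disk z -> C_derive phi z <> 0).
  { intros z Hz E. specialize (Hre z Hz). rewrite E in Hre.
    replace (C_derive f z / 0)%C with (RtoC 0) in Hre.
    - simpl in Hre. lra.
    - apply injective_projections; simpl; unfold Rdiv; ring. }
  pose proof (disk_series_C_derive _ _ Ha) as Ha'.
  pose proof (disk_series_C_derive _ _ Hc) as Hc'.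
  set (t := 1 - beta). assert (Ht : 0 < t) by (unfold t; lra).
  assert (Hti : (t * RtoC (/ t))%C = 1).
  { rewrite <- RtoC_mult, Rinv_r by lra. reflexivity. }
  assert (Hb : RtoC (- beta) = (t - 1)%C).
  { rewrite <- RtoC_minus. f_equal. unfold t; ring. }
  (* Obtained by solving [f' = phi' (beta + t p)] degree by degree. *)
  set (p1 := (RtoC (/ t) * (2 * a 2%nat - 2 * c 2%nat))%C).
  set (p2 := (RtoC (/ t) * (3 * a 3%nat - 3 * c 3%nat) - 2 * c 2%nat * p1)%C).
  set (p3 := (RtoC (/ t) * (4 * a 4%nat - 4 * c 4%nat)
              - 3 * c 3%nat * p1 - 2 * c 2%nat * p2)%C).
  assert (Hp : toeplitz_nonneg p1 p2 p3).
  { apply caratheodory_quotient with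
      (f := fun z => (RtoC (/ t) * (C_derive f z + RtoC (- beta) * C_derive phi z))%C)
      (g := C_derive phi)
      (u := fun n => (RtoC (/ t) * (Cseries_derive a n + RtoC (- beta) * Cseries_derive c n))%C)
      (v := Cseries_derive c).
    - apply C1_on_mult; [apply C1_on_const|].
      apply C1_on_plus; [now apply disk_series_C1 with (Cseries_derive a)|].
      apply C1_on_mult; [apply C1_on_const|].
      now apply disk_series_C1 with (Cseries_derive c).
    - now apply disk_series_C1 with (Cseries_derive c).
    - exact Hn.
    - intros z Hz. pose proof (Hn z Hz) as Hnz.
      replace (RtoC (/ t) * (C_derive f z + RtoC (- beta) * C_derive phi z) / C_derive phi z)%C
        with (RtoC (/ t) * (C_derive f z / C_derive phi z + RtoC (- beta)))%C
        by (field; exact Hnz).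
      specialize (Hre z Hz).
      replace (Re (RtoC (/ t) * (C_derive f z / C_derive phi z + RtoC (- beta)))%C)
        with (/ t * (Re (C_derive f z / C_derive phi z)%C - beta))
        by (unfold Re; simpl; ring).
      apply Rmult_le_pos; [apply Rlt_le, Rinv_0_lt_compat; exact Ht | lra].
    - apply bigO_ext with (1 := Rlt_0_1) (f := fun z => (RtoC (/ t) *
        ((C_derive f z - sum_n (fun j => Cseries_derive a j * z ^ j) 3) + RtoC (- beta) *
         (C_derive phi z - sum_n (fun j => Cseries_derive c j * z ^ j) 3)))%C).
      + intros z _. rewrite !sum_n_3. ring.
      + apply bigO_scal, bigO_plus; [|apply bigO_scal]; now apply disk_series_expands.
    - now apply disk_series_expands.
    - unfold Cseries_derive. simpl. rewrite Hc1. ring.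
    - unfold Cseries_derive. simpl. rewrite Hc1, Ha1, Hb. ring [Hti].
    - unfold Cseries_derive, p1. simpl. rewrite !RtoC_plus, Hb. ring [Hti].
    - unfold Cseries_derive, p2. simpl. rewrite !RtoC_plus, Hb. ring [Hti].
    - unfold Cseries_derive, p3. simpl. rewrite !RtoC_plus, Hb. ring [Hti]. }
  pose proof (convex_toeplitz phi c Hc Hc1 Hn HP) as HT.
  apply Rle_trans with (1 / 8 + 28 / 9 * t + 5 * t ^ 2).
  - apply (hankel_bound_of_coefficients t (c 2%nat) (c 3%nat) (c 4%nat) p1 p2 p3);
      [exact Ht | exact HT | exact Hp | | |]; unfold p3, p2, p1; ring [Hti].
  (* Termwise comparison: 28/9 < 19/6, 5 < 6, and the cubic and quartic terms are positive. *)
  - pose proof (pow_lt t 2 Ht). pose proof (pow_lt t 3 Ht). pose proof (pow_lt t 4 Ht). lra.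
Qed.
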